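(* Let $(X,d,\mu)$, $\Omega$, $\theta\in[0,1)$, the boundary measure $\mathscr H$ on $\partial\Omega$ and the double-phase function $\mathcal H$ be as in the context. Assume that $\Omega$ is bounded, that $\mathcal H$ satisfies the local comparability condition on $\overline\Omega$, and that $\Omega$ supports the weak $(1,1)$-Poincaré inequality. Then there exists a bounded linear operator $T:N^{1,\mathcal H}(\Omega)\to L^{\mathcal H}(\partial\Omega)$ such that, for every $u\in N^{1,\mathcal H}(\Omega)$, $$\lim_{r\to0}\frac1{\mu(B(z,r)\cap\Omega)}\int_{B(z,r)\cap\Omega}|u(y)-Tu(z)|\,d\mu(y)=0$$ for $\mathscr H$-almost every $z\in\partial\Omega$.
   Context: Setting. $(X,d,\mu)$ is a complete metric measure space, where $\mu$ is a $\sigma$-finite Borel regular measure with $0<\mu(B(x,r))<\infty$ for every open ball. $\Omega\subset X$ is a domain such that $0<\mu(B(x,r)\cap\Omega)<\infty$ for all $x\in\overline\Omega$, $r>0$, and $\mu$ satisfies the restricted doubling condition on $\Omega$: there is $C\ge1$ with $\mu(B(x,2r)\cap\Omega)\le C\mu(B(x,r)\cap\Omega)$ for all $x\in\overline\Omega$, $r>0$. $\mathscr H$ is a $\sigma$-finite Borel regular measure on $\partial\Omega$ satisfying, for a fixed $0\le\theta<1$, the upper codimension-$\theta$ condition: there is $C_\theta>0$ with $\mathscr H(B(x,r)\cap\partial\Omega)\le C_\theta\, r^{-\theta}\mu(B(x,r)\cap\Omega)$ for all $x\in\partial\Omega$, $r>0$. Double-phase function. $\mathcal H(x,\xi)=\xi^{p(x)}+a(x)\xi^{q(x)}$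 for $x\in\overline\Omega$, $\xi\ge0$, where $p,q,a$ are measurable on $\overline\Omega$, $1<p(x)<q(x)<\infty$ for all $x$, $1<p^-:=\operatorname{ess\,inf}p\le p^+:=\operatorname{ess\,sup}p<\infty$, $1<q^-:=\operatorname{ess\,inf}q\le q^+:=\operatorname{ess\,sup}q<\infty$, and $0\le a\in L^\infty$. These conditions are assumed on $\overline\Omega$ with respect to $\mu$, and on $\partial\Omega$ with respect to $\mathscr H$. Spaces. $L^{\mathcal H}(\Omega)$ is the space of measurable $u$ on $\Omega$ with $\varrho_{\mathcal H}(u)=\int_\Omega\mathcal H(x,|u|)\,d\mu<\infty$, with Luxemburg norm $\|u\|=\inf\{\tau>0:\varrho_{\mathcal H}(u/\tau)\le1\}$; $L^{\mathcal H}(\partial\Omega)$ is defined in the same way on $\partial\Omega$ with $\mathscr H$ in place of $\mu$. Rectifiable curves are nonconstant, continuous, of finite length $\ell_\gamma$ and parametrized on $[0,\ell_\gamma]$. The $\mathcal H$-modulus of a family $\Gamma$ of rectifiable curves in $\Omega$ is $\inf\int_\Omega\mathcal H(x,h)\,d\mu$ over Borel $h\ge0$ (values in $[0,\infty]$) with $\int_\gamma h\,ds\ge1$ for all $\gamma\in\Gamma$ ($\infty$ if there is no such $h$). A nonnegative Borel function $g$ on $\Omega$ is an $\mathcal H$-weak upper gradient of a measurable $u:\Omega\to[-\infty,\infty]$ if $|u(\gamma(0))-u(\gamma(\ell_\gamma))|\le\int_\gamma g\,ds$ for all rectifiable curves $\gamma$ in $\Omega$ outside a family of $\mathcal H$-modulus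 zero (with $|(\pm\infty)-(\pm\infty)|=\infty$). If $u$ has an $\mathcal H$-weak upper gradient in $L^{\mathcal H}(\Omega)$, then $g_u$ denotes the minimal one ($g_u\le g$ $\mu$-a.e. for every $\mathcal H$-weak upper gradient $g\in L^{\mathcal H}(\Omega)$ of $u$), which exists and is $\mu$-a.e. unique. $N^{1,\mathcal H}(\Omega)$ is the space of everywhere-defined $u\in L^{\mathcal H}(\Omega)$ having an $\mathcal H$-weak upper gradient in $L^{\mathcal H}(\Omega)$, with norm $\|u\|_{N^{1,\mathcal H}(\Omega)}=\|u\|_{L^{\mathcal H}(\Omega)}+\|g_u\|_{L^{\mathcal H}(\Omega)}$, modulo $u\sim v$ iff $\|u-v\|=0$. Local comparability. $\mathcal H$ satisfies the local comparability condition on $E$ if there exist $C\ge1$ and $R_0>0$ such that for every ball $B\subset X$ of radius less than $R_0$, all $x,y\in B\cap E$ and all $\xi\in[0,\infty)$, $\mathcal H(x,\xi)\le C\,\mathcal H(y,C\xi)$. Weak $(1,1)$-Poincaré inequality. $\Omega$ supports it if there are $C>0$, $\lambda>1$ such that for every $u\in L^1_{\mathrm{loc}}(\Omega)$ (integrable on bounded subsets of $\Omega$) with minimal $\mathcal H$-weak upper gradient $g_u$, $\frac1{\mu(B)}\int_B|u-u_B|\,d\mu\le C r\frac1{\mu(\lambda B\cap\Omega)}\int_{\lambda B\cap\Omega}g_u\,d\mu$ for every ball $B=B(x,r)\subset\Omega$; by convention, this assumption includes the same inequality with $B$ replaced by $B\cap\Omega$ on the left-hand side (averages over $B\cap\Omega$)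 for every ball $B=B(x,r)$ with $x\in\overline\Omega$. Here $u_A=\frac1{\mu(A)}\int_A u\,d\mu$ and $\lambda B=B(x,\lambda r)$. *)

(* Defs.v *)
From HB Require Import structures.
From mathcomp Require Import all_boot all_order all_algebra.
From mathcomp Require Import all_classical all_reals all_analysis.
From mathcomp Require Import measurable_realfun ess_sup_inf.

Set Implicit Arguments.
Unset Strict Implicit.
Unset Printing Implicit Defensive.

Import Order.TTheory GRing.Theory Num.Theory.
Import numFieldNormedType.Exports.

Local Open Scope classical_set_scope.
Local Open Scope ring_scope.

#[short(type="completeMetricType")]
HB.structure Definition CompleteMetric (R : numDomainType) :=
  {T of CompletePseudoMetric R T & Metric R T}.

Section metric_notions.
Context {R : realType} {X : completeMetricType R}.
Local Open Scope ereal_scope.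

Definition bdry (A : set X) : set X := closure A `\` interior A.

Definition metric_bounded (A : set X) : Prop :=
  exists (x : X) (r : R), A `<=` ball x r.

Definition domain (A : set X) : Prop := [/\ open A, connected A & A !=set0].

Definition borel_fun (D : set X) (h : X -> \bar R) : Prop :=
  @measurable_fun _ _ (g_sigma_algebraType (@open X)) _ D h.

(* A measure in the sense of geometric measure theory is an outer measure; its
   measurable sets are the Caratheodory measurable ones, and [meas m] is the
   (complete) measure that it induces on them. *)
Definition meas (m : {outer_measure set X -> \bar R}) :
    {measure set (caratheodory_type m) -> \bar R} :=
  (m : set (caratheodory_type m) -> \bar R).

Definition mmeasurable (m : {outer_measure set X -> \bar R}) (D : set X)
    (f : X -> \bar R) : Prop :=
  @measurable_fun _ _ (caratheodory_type m) _ D f.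

Definition borel_regular (m : {outer_measure set X -> \bar R}) : Prop :=
  <<s @open X >> `<=` m.-cara.-measurable /\
  forall A : set X, exists B : set X,
    [/\ <<s @open X >> B, A `<=` B & m A = m B].

Definition avg (m : {outer_measure set X -> \bar R}) (A : set X)
    (f : X -> \bar R) : \bar R :=
  (fine (m A))^-1%:E * \int[meas m]_(x in A) f x.

(* Essential bounds over [D]; the values -oo and +oo given outside [D] are
   neutral for the supremum and the infimum respectively. *)
Definition ess_sup_on (m : {outer_measure set X -> \bar R}) (D : set X)
    (f : X -> R) : \bar R :=
  ess_sup (meas m) (patch (cst -oo) D (EFin \o f)).

Definition ess_inf_on (m : {outer_measure set X -> \bar R}) (D : set X)
    (f : X -> R) : \bar R :=
  ess_inf (meas m) (patch (cst +oo) D (EFin \o f)).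

Definition restricted_doubling (mu : {outer_measure set X -> \bar R})
    (Om : set X) : Prop :=
  exists2 C : R, (1 <= C)%R & forall (x : X) (r : R), closure Om x -> (0 < r)%R ->
    mu (ball x (2 * r) `&` Om) <= C%:E * mu (ball x r `&` Om).

Definition upper_codimension (theta : R)
    (mu nu : {outer_measure set X -> \bar R}) (Om : set X) : Prop :=
  exists2 C : R, (0 < C)%R & forall (x : X) (r : R), bdry Om x -> (0 < r)%R ->
    nu (ball x r `&` bdry Om) <=
      (C * r `^ (- theta))%:E * mu (ball x r `&` Om).

End metric_notions.

Section double_phase.
Context {R : realType} {X : completeMetricType R}.
Variables (p q a : X -> R).
Local Open Scope ereal_scope.

(* The variable [xi] ranges over [0, +oo]. *)
Definition dphase (x : X) (xi : \bar R) : \bar R :=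
  xi `^ p x + (a x)%:E * xi `^ q x.

(* The inequalities ess inf <= ess sup are automatic when [D] is not null, and
   meaningless when it is. *)
Definition dphase_data (m : {outer_measure set X -> \bar R}) (D : set X) :=
  [/\ [/\ mmeasurable m D (EFin \o p), mmeasurable m D (EFin \o q) &
          mmeasurable m D (EFin \o a)],
      forall x, D x -> [/\ (1 < p x)%R, (p x < q x)%R & (0 <= a x)%R],
      1 < ess_inf_on m D p /\ ess_sup_on m D p < +oo,
      1 < ess_inf_on m D q /\ ess_sup_on m D q < +oo &
      ess_sup_on m D a < +oo].

Definition local_comparability (E : set X) : Prop :=
  exists C R0 : R, [/\ (1 <= C)%R, (0 < R0)%R &
    forall (z : X) (r : R), (0 < r)%R -> (r < R0)%R ->
    forall x y : X, (ball z r `&` E) x -> (ball z r `&` E) y ->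
    forall xi : R, (0 <= xi)%R ->
      dphase x xi%:E <= C%:E * dphase y (C * xi)%:E].

Definition dmodular (m : {outer_measure set X -> \bar R}) (D : set X)
    (u : X -> \bar R) : \bar R :=
  \int[meas m]_(x in D) dphase x `|u x|.

Definition LH (m : {outer_measure set X -> \bar R}) (D : set X)
    (u : X -> \bar R) : Prop :=
  mmeasurable m D u /\ dmodular m D u < +oo.

Definition LH_norm (m : {outer_measure set X -> \bar R}) (D : set X)
    (u : X -> \bar R) : \bar R :=
  ereal_inf [set tau%:E | tau in
    [set tau : R | (0 < tau)%R /\
                   dmodular m D (fun x => tau^-1%:E * u x) <= 1]].

End double_phase.

Section curves.
Context {R : realType} {X : completeMetricType R}.
Local Open Scope ereal_scope.

Definition curve_variation (g : R -> X) (a b : R) (s : seq R) : R :=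
  (\sum_(0 <= n < size s) mdist (g (nth b (a :: s) n)) (g (nth b s n)))%R.

Definition curve_length (g : R -> X) (a b : R) : \bar R :=
  ereal_sup [set (curve_variation g a b s)%:E | s in [set s | itv_partition a b s]].

(* Nonconstant rectifiable curves in [Om], parametrized by arc length; only the
   values of [rmap] on [0, rlen] matter. *)
Record rcurve (Om : set X) := RCurve {
  rmap : R -> X ;
  rlen : R ;
  rlen_gt0 : (0 < rlen)%R ;
  rmap_cont : {within `[0%R, rlen], continuous rmap} ;
  rmap_arclength : forall s t : R, (0 <= s)%R -> (s <= t)%R -> (t <= rlen)%R ->
    curve_length rmap s t = (t - s)%:E ;
  rmap_in : forall t : R, (0 <= t)%R -> (t <= rlen)%R -> Om (rmap t) }.

Definition path_integral (Om : set X) (c : rcurve Om) (h : X -> \bar R)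
    : \bar R :=
  \int[lebesgue_measure]_(t in `[0%R, rlen c]) h (rmap c t).

End curves.

Section newtonian.
Context {R : realType} {X : completeMetricType R}.
Variables (p q a : X -> R) (mu : {outer_measure set X -> \bar R}) (Om : set X).
Local Open Scope ereal_scope.

Definition modulus (G : set (rcurve Om)) : \bar R :=
  ereal_inf [set \int[meas mu]_(x in Om) dphase p q a x (h x) | h in
    [set h : X -> \bar R | [/\ borel_fun Om h, forall x, Om x -> 0 <= h x &
      forall c, G c -> 1 <= path_integral c h]]].

(* The convention |(+oo) - (+oo)| = |(-oo) - (-oo)| = +oo is built in:
   [+oo - +oo] and [-oo - -oo] are both [-oo] in [\bar R]. *)
Definition weak_upper_gradient (u g : X -> \bar R) : Prop :=
  [/\ borel_fun Om g, forall x, Om x -> 0 <= g x &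
    exists2 G : set (rcurve Om), modulus G = 0 &
      forall c, ~ G c ->
        `|u (rmap c 0%R) - u (rmap c (rlen c))| <= path_integral c g].

Definition LH_wug (u g : X -> \bar R) : Prop :=
  weak_upper_gradient u g /\ LH p q a mu Om g.

Definition is_min_wug (u g : X -> \bar R) : Prop :=
  LH_wug u g /\
  forall g', LH_wug u g' -> {ae meas mu, forall x, Om x -> g x <= g' x}.

Definition min_wug (u : X -> \bar R) : X -> \bar R :=
  xget (cst 0) [set g | is_min_wug u g].

Definition N1H (u : X -> \bar R) : Prop :=
  LH p q a mu Om u /\ exists g, LH_wug u g.

Definition N1H_norm (u : X -> \bar R) : \bar R :=
  LH_norm p q a mu Om u + LH_norm p q a mu Om (min_wug u).

(* Functions in [N1H] may take infinite values; [u x - v x] and [c * u x + v x]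
   are computed in [\bar R], where [+oo - +oo = -oo]. Such indeterminate points
   do not matter: a.e. curve avoids the points where [u] or [v] is infinite. *)
Definition N1H_equiv (u v : X -> \bar R) : Prop :=
  N1H_norm (fun x => u x - v x) = 0.

Definition L1loc (u : X -> \bar R) : Prop :=
  forall A : set X, A `<=` Om -> metric_bounded A -> mu.-cara.-measurable A ->
    (meas mu).-integrable A u.

Definition weak_poincare : Prop :=
  exists C lambda : R, [/\ (0 < C)%R, (1 < lambda)%R &
    forall u : X -> \bar R, mmeasurable mu Om u -> L1loc u ->
      (exists g, LH_wug u g) ->
    let bound (x : X) (r : R) :=
      (C * r)%:E * avg mu (ball x (lambda * r) `&` Om) (min_wug u) in
    let oscillation (B : set X) :=
      avg mu B (fun y => `|u y - avg mu B u|) in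
    (forall (x : X) (r : R), (0 < r)%R -> ball x r `<=` Om ->
       oscillation (ball x r) <= bound x r) /\
    (forall (x : X) (r : R), (0 < r)%R -> closure Om x ->
       oscillation (ball x r `&` Om) <= bound x r)].

End newtonian.

(* Main.v *)
Require Import Defs.
From HB Require Import structures.
From mathcomp Require Import all_boot all_order all_algebra.
From mathcomp Require Import all_classical all_reals all_analysis.
From mathcomp Require Import measurable_realfun ess_sup_inf.
From mathcomp Require Import ring lra.

Set Implicit Arguments.
Unset Strict Implicit.
Unset Printing Implicit Defensive.

Import Order.TTheory GRing.Theory Num.Theory.
Import numFieldNormedType.Exports.

Local Open Scope classical_set_scope.
Local Open Scope ring_scope.
Local Open Scope ereal_scope.

(** Fix a boundary point [z] and the balls [B k] of radius [2^-k * rho] about it.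
    By the Poincare inequality the averages of [u] over the sets [B k `&` Om]
    differ from one step to the next by at most a multiple of [2^-k] times the
    average of the gradient [g], so they converge as soon as
    [sum_k 2^-k avg (B k) g] is finite, and the limit [T u z] is bounded by a
    multiple of [sum_k 2^-k avg (B k) (|u| + g)].  A Jensen-type inequality
    together with local comparability moves the double-phase function inside
    the averages and from [z] to the variable of integration.  Finally, the
    codimension condition and doubling give, for [f >= 0],
    [int_(bdry Om) avg (ball z r `&` Om) f dnu <= K * r^(-theta) * int_Om f dmu],
    and the resulting series [sum_k 2^-k * 2^(k * theta)] converges because
    [theta < 1]. *)

(** * The double-phase function *)

(** The Jensen-type inequality holds only up to an extra term: it is kept in the form [avg F * phi s
    <= s * avg (phi F) + s * phi s], linear in the average and free of division, so that it can be
    summed over the scales and allows infinite values. The scales are weighted by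
    [2^-1 * 2^-1 ^+ k], which sum to 1, so after summation the extra term is still [s * phi s]. A
    number [s] with [2 * s] at most the weighted series then absorbs it, and [phi s] is at most an
    integrable majorant; this is why a factor 2 is built into the bound on the trace. The trace is
    defined as the number to which [u] converges in mean over shrinking balls. Such a number is
    unique, so linearity and independence of the representative reduce to properties of averages,
    and measurability follows from convergence along a sequence of radii. The upper bounds on the
    exponents enter only qualitatively, through the finiteness of modulars of dilated functions; the
    norm estimate shrinks its arguments, and its constant does not involve them. *)

Section dphase_lemmas.
Context {R : realType} {X : completeMetricType R}.
Variables (p q a : X -> R) (x : X).
Hypotheses (p1 : (1 < p x)%R) (q1 : (1 < q x)%R) (a0 : (0 <= a x)%R).
Local Notation phi := (dphase p q a x).

Let p0 : (0 < p x)%R. Proof. exact: lt_trans p1. Qed.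
Let q0 : (0 < q x)%R. Proof. exact: lt_trans q1. Qed.

Lemma dphase_ge0 (s : \bar R) : 0 <= phi s.
Proof. by rewrite adde_ge0 ?mule_ge0 ?poweR_ge0 ?lee_fin. Qed.

Lemma dphase_EFin (s : R) : phi s%:E = (s `^ p x + a x * s `^ q x)%:E.
Proof. by rewrite /dphase !poweR_EFin EFinD EFinM. Qed.

Lemma dphase0 : phi 0 = 0.
Proof. by rewrite /dphase !poweR0r ?gt_eqF// mule0 adde0. Qed.

Lemma dphasey : phi +oo = +oo.
Proof.
rewrite /dphase !poweRyr ?gt_eqF// addye//.
by rewrite gt_eqF// (@lt_le_trans _ _ 0) ?ltNyr// mule_ge0 ?lee_fin.
Qed.

Lemma le_dphase (s t : \bar R) : 0 <= s -> s <= t -> phi s <= phi t.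
Proof.
move=> s0 st; have t0 := le_trans s0 st.
have le_poweR r : (0 < r)%R -> s `^ r <= t `^ r.
  by move=> r0; apply: gt0_ler_poweR => //; rewrite ?ltW// in_itv/= leey ?s0 ?t0.
by rewrite leeD ?le_poweR// lee_wpmul2l ?lee_fin ?le_poweR.
Qed.

(** Both exponents exceed 1, so the corresponding powers of [c] are at most [c]. This stands in for
    convexity. *)
Lemma dphase_shrink (c : R) (s : \bar R) : (0 <= c <= 1)%R -> 0 <= s ->
  phi (c%:E * s) <= c%:E * phi s.
Proof.
rewrite le_eqVlt => /andP[/orP[/eqP <- _ _|c0 c1 s0]].
  by rewrite !mul0e dphase0.
rewrite ge0_muleDr ?mule_ge0 ?poweR_ge0 ?lee_fin//.
have shrink r : (1 < r)%R -> (c%:E * s) `^ r <= c%:E * s `^ r.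
  move=> r1; rewrite poweRM ?lee_fin ?(ltW c0)// lee_wpmul2r ?poweR_ge0//.
  by rewrite poweR_EFin lee_fin ge1r_powR ?c0// ltW.
by rewrite leeD ?shrink// muleCA lee_wpmul2l ?shrink ?lee_fin.
Qed.

(** The Delta_2 property: bounded exponents let a dilation be pulled out as a constant factor. *)
Lemma dphase_dilate (c M : R) (s : \bar R) : (1 <= c)%R -> (p x <= M)%R ->
  (q x <= M)%R -> 0 <= s -> phi (c%:E * s) <= (c `^ M)%:E * phi s.
Proof.
move=> c1 pM qM s0; have c0 : (0 <= c)%R := le_trans ler01 c1.
rewrite ge0_muleDr ?mule_ge0 ?poweR_ge0 ?lee_fin//.
have dilate r : (r <= M)%R -> (c%:E * s) `^ r <= (c `^ M)%:E * s `^ r.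
  move=> rM; rewrite poweRM ?lee_fin// lee_wpmul2r ?poweR_ge0//.
  by rewrite poweR_EFin lee_fin ler_powR.
by rewrite leeD ?dilate// muleCA lee_wpmul2l ?dilate ?lee_fin.
Qed.

(* The monotonicity of [phi s / s], in a form that can be averaged over [s]:
   it replaces Jensen's inequality below. *)
Lemma dphase_tangent (s : R) (t : \bar R) : (0 <= s)%R -> 0 <= t ->
  t * phi s%:E <= s%:E * phi t + s%:E * phi s%:E.
Proof.
move=> s0 t0; have [ts|st] := leP t s%:E.
  apply: (@le_trans _ _ (s%:E * phi s%:E)).
    by rewrite lee_wpmul2r ?dphase_ge0.
  by rewrite leeDr// mule_ge0 ?dphase_ge0.
apply: (@le_trans _ _ (s%:E * phi t)); last first.
  by rewrite leeDl// mule_ge0 ?dphase_ge0.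
move: s0; rewrite le_eqVlt => /orP[/eqP <-|s0].
  by rewrite dphase0 mule0 mul0e.
case: t st t0 => [t|_ _|//].
  rewrite lte_fin => st t0; have t0' : (0 < t)%R := lt_trans s0 st.
  have -> : s%:E = (s / t)%:E * t%:E :> \bar R by rewrite -EFinM divfK ?gt_eqF.
  rewrite (le_trans (lee_wpmul2l t0 (dphase_shrink _ t0)))//.
    by rewrite divr_ge0 ?(ltW s0) ?(ltW t0')//= ler_pdivrMr// mul1r ltW.
  by rewrite muleA [t%:E * _]muleC.
by rewrite dphasey mulry gtr0_sg// mul1e leey.
Qed.

(** For [s > 1] the first term of [phi s] already dominates [s]. On sets of finite measure this
    makes functions of finite modular integrable. *)
Lemma le_dphase1 (s : \bar R) : 0 <= s -> s <= 1 + phi s.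
Proof.
case: s => [s s0|_|//]; last by rewrite dphasey addey.
have [s1|s1] := leP s 1%R.
  by rewrite (@le_trans _ _ 1)// leeDl// dphase_ge0.
rewrite dphase_EFin -EFinD lee_fin (@le_trans _ _ (s `^ p x)%R)//.
  by rewrite le1r_powR// ltW.
by rewrite addrCA lerDl addr_ge0// mulr_ge0// powR_ge0.
Qed.

End dphase_lemmas.

Section measurable_dphase.
Context {R : realType} d (T : measurableType d).

(** Base and exponent both vary with the point, so [powR] is unfolded: it is [expR (g x * ln (f x))]
    where [f x] is nonzero, and the truth value of [g x == 0] where [f x] vanishes. *)
Lemma measurable_fun_powR2 (D : set T) (f g : T -> R) :
  measurable_fun D f -> measurable_fun D g ->
  measurable_fun D (fun x => f x `^ g x)%R.
Proof.
move=> mf mg mD; rewrite /powR.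
have eq0 h : measurable_fun D h -> measurable_fun D (fun x => h x == 0%R :> R).
  by move=> mh; apply: measurable_fun_eqr => //; exact: measurable_cst.
have sub h b : measurable_fun D h ->
    measurable_fun (D `&` (fun x => f x == 0%R) @^-1` [set b]) (h : T -> R).
  exact: measurable_funS.
apply: measurable_fun_if => //; first exact: eq0.
- apply: (@measurable_funS _ _ _ _ D) => //.
  rewrite [X in measurable_fun _ X](_ : _ =
    (fun b : bool => b%:R) \o (fun x => g x == 0%R)) //.
  by apply: measurableT_comp => //; exact: eq0.
- apply: measurableT_comp => //; apply: measurable_funM; apply: sub => //.
  exact: measurableT_comp.
Qed.

Lemma measurable_fun_poweR2 (D : set T) (f : T -> \bar R) (g : T -> R) :
  (forall x, D x -> 0 <= f x /\ (0 < g x)%R) ->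
  measurable_fun D f -> measurable_fun D g ->
  measurable_fun D (fun x => f x `^ g x).
Proof.
move=> fg0 mf mg.
apply: (@eq_measurable_fun _ _ _ _ _ (fun x => if f x == +oo then +oo%E
    else (fine (f x) `^ g x)%:E)).
  move=> y /[!inE] /fg0[f0 g0].
  by case: (f y) f0 => [r|_|//] //; rewrite eqxx poweRyr// gt_eqF.
move=> mD; apply: measurable_fun_if => //.
- apply: (measurable_fun_bool true) => //.
  rewrite (_ : _ `&` _ = D `&` f @^-1` [set +oo]).
    exact: mf.
  by apply/seteqP; split => y [Dy /eqP fy]; split => //=; exact/eqP.
- apply: (@measurable_funS _ _ _ _ D) => //.
  apply/measurable_EFinP/measurable_fun_powR2 => //.
  exact: measurableT_comp.
Qed.

End measurable_dphase.

Section mmeasurable_dphase.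
Context {R : realType} {X : completeMetricType R}.
Variables (p q a : X -> R) (m : {outer_measure set X -> \bar R}) (D : set X).

Lemma mmeasurable_dphase (f : X -> \bar R) :
  mmeasurable m D (EFin \o p) -> mmeasurable m D (EFin \o q) ->
  mmeasurable m D (EFin \o a) ->
  (forall x, D x -> (1 < p x)%R /\ (1 < q x)%R) ->
  (forall x, D x -> 0 <= f x) -> mmeasurable m D f ->
  mmeasurable m D (fun x => dphase p q a x (f x)).
Proof.
move=> mp mq ma pq f0 mf; apply: emeasurable_funD.
  apply: measurable_fun_poweR2 => //; last exact/measurable_EFinP.
  by move=> x Dx; split; [exact: f0|have [] := pq _ Dx; move/(lt_trans ltr01)].
apply: emeasurable_funM => //.
apply: measurable_fun_poweR2 => //; last exact/measurable_EFinP.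
by move=> x Dx; split; [exact: f0|have [_] := pq _ Dx; move/(lt_trans ltr01)].
Qed.

End mmeasurable_dphase.

(** * Averages *)

Lemma ball_open_metric {R : realType} {X : completeMetricType R} (x : X) (r : R) :
  open (ball x r).
Proof.
rewrite openE => y; rewrite ballEmdist/= => xy.
apply/nbhs_ballP; exists (r - mdist x y)%R => /=; first by rewrite subr_gt0.
move=> z; rewrite ballEmdist/= ltrBrDl; apply: le_lt_trans.
exact: metric_triangle.
Qed.

Section borel_regular_lemmas.
Context {R : realType} {X : completeMetricType R}.
Variable m : {outer_measure set X -> \bar R}.
Hypothesis m_regular : borel_regular m.

Lemma open_cara (A : set X) : open A -> m.-cara.-measurable A.
Proof. by move=> oA; apply: m_regular.1; exact: sub_sigma_algebra. Qed.

Lemma closed_cara (A : set X) : closed A -> m.-cara.-measurable A.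
Proof. by move=> cA; rewrite -[A]setCK; apply/measurableC/open_cara/closed_openC. Qed.

Lemma bdry_cara (A : set X) : m.-cara.-measurable (bdry A).
Proof.
apply: measurableD; first exact/closed_cara/closed_closure.
exact/open_cara/open_interior.
Qed.

Lemma ball_cara (x : X) (r : R) : m.-cara.-measurable (ball x r).
Proof. exact/open_cara/ball_open_metric. Qed.

End borel_regular_lemmas.

Section averages.
Context {R : realType} {X : completeMetricType R}.
Variable m : {outer_measure set X -> \bar R}.
Implicit Types (A B : set X) (f g : X -> \bar R).

Lemma avg_ge0 A f : (forall x, A x -> 0 <= f x) -> 0 <= avg m A f.
Proof.
by move=> f0; rewrite mule_ge0 ?integral_ge0// lee_fin invr_ge0 fine_ge0.
Qed.

Lemma le_avg A f g : m.-cara.-measurable A ->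
  (forall x, A x -> 0 <= f x) -> mmeasurable m A f -> mmeasurable m A g ->
  (forall x, A x -> f x <= g x) -> avg m A f <= avg m A g.
Proof.
move=> mA f0 mf mg fg; rewrite lee_wpmul2l ?ge0_le_integral//.
by rewrite lee_fin invr_ge0 fine_ge0.
Qed.

Lemma avg_cst A (c : R) : m.-cara.-measurable A -> 0 < m A < +oo ->
  avg m A (cst c%:E) = c%:E.
Proof.
move=> mA /andP[A0 Aoo].
have Afin : m A \is a fin_num by rewrite ge0_fin_numE ?ltW.
rewrite /avg integral_cst// -[X in _ * (_ * X)](fineK Afin) -!EFinM mulrCA.
by rewrite mulVf ?mulr1// gt_eqF// fine_gt0// A0.
Qed.

Lemma avgZ A (c : R) f : m.-cara.-measurable A -> (0 <= c)%R ->
  (forall x, A x -> 0 <= f x) -> mmeasurable m A f ->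
  avg m A (fun x => c%:E * f x) = c%:E * avg m A f.
Proof. by move=> mA c0 f0 mf; rewrite /avg ge0_integralZl_EFin// muleCA. Qed.

Lemma avgD A f g : m.-cara.-measurable A ->
  (forall x, A x -> 0 <= f x) -> (forall x, A x -> 0 <= g x) ->
  mmeasurable m A f -> mmeasurable m A g ->
  avg m A (fun x => f x + g x) = avg m A f + avg m A g.
Proof.
move=> mA f0 g0 mf mg; rewrite /avg ge0_integralD// ge0_muleDr//;
  exact: integral_ge0.
Qed.

Lemma avg_subset A B (c : R) f : m.-cara.-measurable A -> m.-cara.-measurable B ->
  A `<=` B -> 0 < m A -> m B < +oo -> m B <= c%:E * m A ->
  (forall x, B x -> 0 <= f x) -> mmeasurable m B f ->
  avg m A f <= c%:E * avg m B f.
Proof.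
move=> mA mB AB A0 Boo BcA f0 mf.
have B0 : 0 < m B by apply: lt_le_trans A0 _; exact: le_outer_measure.
have Aoo : m A < +oo by apply: le_lt_trans Boo; exact: le_outer_measure.
have Afin : m A \is a fin_num by rewrite ge0_fin_numE ?ltW.
have Bfin : m B \is a fin_num by rewrite ge0_fin_numE ?ltW.
have fA0 : (0 < fine (m A))%R by rewrite fine_gt0// A0.
have fB0 : (0 < fine (m B))%R by rewrite fine_gt0// B0.
have cle : ((fine (m A))^-1 <= c * (fine (m B))^-1)%R.
  by rewrite ler_pdivlMr// ler_pdivrMl// mulrC -lee_fin EFinM !fineK.
rewrite /avg muleA -EFinM; apply: lee_pmul => //.
- by rewrite lee_fin invr_ge0 ltW.
- by apply: integral_ge0 => x /AB; exact: f0.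
- exact: ge0_subset_integral.
Qed.

End averages.

Section dphase_averages.
Context {R : realType} {X : completeMetricType R}.
Variables (p q a : X -> R) (m : {outer_measure set X -> \bar R}).
Variables (A : set X) (mA : m.-cara.-measurable A) (Afin : 0 < m A < +oo).
Variables (z : X) (p1 : (1 < p z)%R) (q1 : (1 < q z)%R) (a0 : (0 <= a z)%R).
Variables (f : X -> \bar R) (f0 : forall x, A x -> 0 <= f x).
Hypothesis mf : mmeasurable m A f.

Lemma mmeasurable_dphase_comp : mmeasurable m A (fun y => dphase p q a z (f y)).
Proof.
apply: (@mmeasurable_dphase _ _ (cst (p z)) (cst (q z)) (cst (a z))) => //.
- exact: (measurable_cst (p z)%:E).
- exact: (measurable_cst (q z)%:E).
- exact: (measurable_cst (a z)%:E).
Qed.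

(** For fixed [s] the inequality [dphase_tangent] is linear in [t] and [phi t], so it can be
    averaged with [t = f y]; its constant term is its own average. *)
Lemma avg_dphase_tangent (s : R) : (0 <= s)%R ->
  avg m A f * dphase p q a z s%:E <=
    s%:E * avg m A (fun y => dphase p q a z (f y)) + s%:E * dphase p q a z s%:E.
Proof.
move=> s0; have mphi := mmeasurable_dphase_comp.
have phi0 t : 0 <= dphase p q a z t by exact: dphase_ge0.
have [r [r0 rE]] : exists r : R, (0 <= r)%R /\ dphase p q a z s%:E = r%:E.
  exists (fine (dphase p q a z s%:E)); split; first exact: fine_ge0.
  by rewrite dphase_EFin.
have -> : avg m A f * dphase p q a z s%:E = avg m A (fun y => r%:E * f y).
  by rewrite avgZ// rE muleC.
have -> : s%:E * avg m A (fun y => dphase p q a z (f y)) +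
    s%:E * dphase p q a z s%:E =
    avg m A (fun y => s%:E * dphase p q a z (f y) + cst (s * r)%:E y).
  rewrite [RHS]avgD//; first by rewrite avgZ// avg_cst// rE EFinM.
  - by move=> x Ax; rewrite mule_ge0.
  - by move=> x Ax; rewrite lee_fin mulr_ge0.
  - exact: measurable_funeM.
  - exact: measurable_cst.
apply: le_avg => //.
- by move=> x Ax; rewrite mule_ge0// f0.
- exact: measurable_funeM.
- apply: emeasurable_funD; [exact: measurable_funeM|exact: measurable_cst].
- move=> x Ax /=; rewrite EFinM -rE muleC.
  by apply: dphase_tangent => //; exact: f0.
Qed.

Variables (c : R) (c0 : (0 < c)%R).
Hypotheses (mp : mmeasurable m A (EFin \o p)) (mq : mmeasurable m A (EFin \o q)).
Hypotheses (ma : mmeasurable m A (EFin \o a)).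
Hypothesis pqa : forall x, A x -> [/\ (1 < p x)%R, (1 < q x)%R & (0 <= a x)%R].
Hypothesis comparable : forall y (t : R), A y -> (0 <= t)%R ->
  dphase p q a z t%:E <= c%:E * dphase p q a y (c * t)%:E.

Lemma avg_dphase_comparable :
  avg m A (fun y => dphase p q a z (f y)) <=
    c%:E * avg m A (fun y => dphase p q a y (c%:E * f y)).
Proof.
have cf0 x : A x -> 0 <= c%:E * f x by move=> Ax; rewrite mule_ge0 ?f0// lee_fin ltW.
have mphi : mmeasurable m A (fun y => dphase p q a y (c%:E * f y)).
  apply: mmeasurable_dphase => //; last exact: measurable_funeM.
  by move=> x /pqa[].
have phi0 x t : A x -> 0 <= dphase p q a x t.
  by move=> /pqa[? ? ?]; exact: dphase_ge0.
rewrite -avgZ ?(ltW c0)//; last by move=> x Ax; exact: phi0.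
apply: le_avg => //.
- by move=> x Ax; exact: dphase_ge0.
- exact: mmeasurable_dphase_comp.
- exact: measurable_funeM.
(* [comparable] concerns finite arguments; at an infinite value of [f] both sides are [+oo]. *)
move=> x Ax; have := f0 Ax; case: (f x) => [t|_|//].
  by rewrite lee_fin -EFinM => t0; exact: comparable.
have [px qx ax] := pqa Ax.
by rewrite mulry gtr0_sg// mul1e !dphasey// mulry gtr0_sg// mul1e.
Qed.

End dphase_averages.

(** * Separated families in a doubling domain *)

Section doubling_geometry.
Context {R : realType} {X : completeMetricType R}.
Variables (mu : {outer_measure set X -> \bar R}) (Om : set X).
Hypothesis mu_regular : borel_regular mu.
Hypothesis Om_open : open Om.
Hypothesis mu_ball_Om : forall (x : X) (r : R), closure Om x -> (0 < r)%R ->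
  0 < mu (ball x r `&` Om) < +oo.
Variables (C : R) (C1 : (1 <= C)%R).
Hypothesis doubling : forall (x : X) (r : R), closure Om x -> (0 < r)%R ->
  mu (ball x (2 * r) `&` Om) <= C%:E * mu (ball x r `&` Om).

Lemma ballOm_cara (x : X) (r : R) : mu.-cara.-measurable (ball x r `&` Om).
Proof. by apply: measurableI; [exact: ball_cara|exact: open_cara]. Qed.

Lemma doubling_iter n (x : X) (r : R) : closure Om x -> (0 < r)%R ->
  mu (ball x (2 ^+ n * r) `&` Om) <= (C ^+ n)%:E * mu (ball x r `&` Om).
Proof.
move=> Ox r0; elim: n => [|n ih]; first by rewrite !expr0 mul1r mul1e.
rewrite exprS -mulrA (le_trans (doubling _ _))// ?mulr_gt0 ?exprn_gt0//.
by rewrite exprS EFinM -muleA lee_wpmul2l// lee_fin (le_trans ler01).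
Qed.

(* The balls of radius [rho / 2] about the points of a separated family are
   disjoint and each of them carries a fixed fraction of the measure of a ball
   containing them all. *)
Lemma separated_card m n (y : X) (rho : R) (z : 'I_n -> X) (P : pred 'I_n) :
  closure Om y -> (0 < rho)%R -> (forall i, P i -> closure Om (z i)) ->
  (forall i j, P i -> P j -> i != j -> ~ ball (z i) rho (z j)) ->
  (forall i, P i -> ball y (2 ^+ m * rho) (z i)) ->
  (#|P|%:R <= C ^+ (m + 3) :> R)%R.
Proof.
move=> Oy rho0 Oz sep zy.
have hrho0 : (0 < rho / 2)%R by rewrite divr_gt0.
have m0 : (0 < 2 ^+ m * rho)%R by rewrite mulr_gt0 ?exprn_gt0.
have m1 : (rho <= 2 ^+ m * rho)%R by rewrite ler_peMl ?exprn_ege1 ?ler1n// ltW.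
pose F i := ball (z i) (rho / 2) `&` Om.
pose V := ball y (2 ^+ m.+1 * rho) `&` Om.
have mF i : mu.-cara.-measurable (F i) by exact: ballOm_cara.
have tF : trivIset (fun i => P i) F.
  apply/trivIsetP => i j Pi Pj ij; rewrite -subset0 => w [[ziw _] [zjw _]].
  by apply: (sep i j Pi Pj ij); exact: ball_splitl ziw zjw.
have V0 : 0 < mu V < +oo by apply: mu_ball_Om => //; rewrite mulr_gt0 ?exprn_gt0.
have Vfin : mu V \is a fin_num by rewrite ge0_fin_numE ?ltW//; case/andP: V0.
(* Since [z i] is within [2 ^+ m * rho] of [y], the set [V] lies in the ball about [z i] of radius
   [2 ^+ (m + 2) * rho], which is [m + 3] doublings of [rho / 2]. *)
have lower i : P i -> mu V <= (C ^+ (m + 3))%:E * mu (F i).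
  move=> Pi; rewrite (le_trans _ (doubling_iter _ (Oz _ Pi) hrho0))//.
  apply: le_outer_measure => w [yw Ow]; split => //.
  have := ball_triangle (ball_sym (zy _ Pi)) yw; apply: le_ball.
  rewrite !exprS exprD; set e := (2 ^+ m)%R in m0 m1 *; nra.
have upper : \sum_(i < n | P i) mu (F i) <= mu V.
  have /(_ n P F (fun i _ => mF i) tF) <- := measure_bigsetU_ord_cond (meas mu).
  apply: le_outer_measure; apply: (big_ind (fun A => A `<=` V)) => //.
    by move=> A B AV BV; rewrite subUset.
  move=> i Pi w [ziw Ow]; split => //.
  have := ball_triangle (zy _ Pi) ziw; apply: le_ball.
  rewrite exprS; set e := (2 ^+ m)%R in m0 m1 *; nra.
have : (#|P|%:R)%:E * mu V <= (C ^+ (m + 3))%:E * mu V.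
  apply: le_trans (lee_wpmul2l _ upper); last first.
    by rewrite lee_fin exprn_ge0// (le_trans ler01).
  rewrite ge0_sume_distrr//.
  rewrite (le_trans _ (lee_sum _ (fun i (Pi : P i) => lower i Pi)))//.
  under eq_bigr do rewrite -(fineK Vfin).
  by rewrite sumEFin sumr_const -[X in _ * X](fineK Vfin) -EFinM mulr_natl.
by rewrite -(fineK Vfin) -!EFinM lee_fin ler_pM2r// fine_gt0.
Qed.

Definition separated (rho : R) (n : nat) (z : nat -> X) : Prop :=
  forall i j, (i < n)%N -> (j < n)%N -> i != j -> ~ ball (z i) rho (z j).

(** The size of separated families is bounded, so one of largest size exists; a point it failed to
    cover could be added to it. *)
Lemma maximal_net (E : set X) (rho : R) : metric_bounded Om -> Om !=set0 ->
  E `<=` closure Om -> (0 < rho)%R ->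
  exists n (z : nat -> X), [/\ forall i, (i < n)%N -> E (z i),
    separated rho n z & forall x, E x -> exists2 i, (i < n)%N & ball (z i) rho x].
Proof.
move=> [x0 [r Omr]] [y Oy] EO rho0.
pose P n := `[< exists z, (forall i, (i < n)%N -> E (z i)) /\ separated rho n z >].
(* Points of [closure Om] lie within 1 of [Om], hence within [2 * (r + 1)] of [y]; this [m] puts
   them all in one ball of the kind counted by [separated_card]. *)
have [m rm] : exists m, (2 * (r + 1) <= 2 ^+ m * rho)%R.
  pose b := Num.trunc (2 * (r + 1) / rho); exists b.+1.
  rewrite -ler_pdivrMr// (le_trans (ltW (truncnS_gt _)))//.
  by rewrite -natrX ler_nat ltnW// ltn_expl.
have [M CM] : exists M : nat, (C ^+ (m + 3) <= M%:R)%R.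
  by exists (Num.trunc (C ^+ (m + 3))).+1; exact/ltW/truncnS_gt.
have P0 : exists n, P n by exists 0%N; apply/asboolP; exists (cst point).
have Pub n : P n -> (n <= M)%N.
  move=> /asboolP[z [Ez zsep]].
  have zO (i : 'I_n) : predT i -> closure Om (z i) by move=> _; exact/EO/Ez.
  have := @separated_card m n y rho (z \o val) predT (subset_closure Oy) rho0 zO.
  rewrite card_ord -(ler_nat R) => /(_ _ _)/le_trans; apply => //.
  - by move=> i j _ _; rewrite -val_eqE; exact: (zsep i j (ltn_ord i) (ltn_ord j)).
  - move=> i _; have [w [Ow ziw]] := zO i isT _ (nbhsx_ballx (z i) 1%R ltr01).
    have := ball_triangle (ball_triangle (ball_sym (Omr _ Oy)) (Omr _ Ow)) (ball_sym ziw).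
    by apply: le_ball; lra.
case: (ex_maxnP P0 Pub) => n /asboolP[z [Ez zsep]] nmax; exists n, z; split => //.
move=> x Ex; apply: contrapT => nx.
have nxball i : (i < n)%N -> ~ ball (z i) rho x by move=> i_n xi; apply: nx; exists i.
have : P n.+1.
  apply/asboolP; exists (fun k => if k == n then x else z k); split.
    by move=> i; rewrite ltnS leq_eqVlt; case: (i == n) => /=; [move=> _|exact: Ez].
  move=> i j; rewrite !ltnS [(i <= n)%N]leq_eqVlt [(j <= n)%N]leq_eqVlt.
  case: (eqVneq i n) => [->|_]; case: (eqVneq j n) => [->|_] /=.
  - by [].
  - by move=> _ jn _ /ball_sym; exact: nxball.
  - by move=> i_n _ _; exact: nxball.
  - exact: zsep.
by move=> /nmax; rewrite ltnn.
Qed.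

End doubling_geometry.

(** * Integrating ball averages over the boundary *)

Section trace_of_averages.
Context {R : realType} {X : completeMetricType R}.
Variables (mu nu : {outer_measure set X -> \bar R}) (Om : set X).
Hypotheses (mu_regular : borel_regular mu) (nu_regular : borel_regular nu).
Hypothesis Om_open : open Om.
Hypothesis Om_bounded : metric_bounded Om.
Hypothesis Om_neq0 : Om !=set0.
Hypothesis mu_ball_Om : forall (x : X) (r : R), closure Om x -> (0 < r)%R ->
  0 < mu (ball x r `&` Om) < +oo.
Variables (C : R) (C1 : (1 <= C)%R).
Hypothesis doubling : forall (x : X) (r : R), closure Om x -> (0 < r)%R ->
  mu (ball x (2 * r) `&` Om) <= C%:E * mu (ball x r `&` Om).
Variables (theta K : R) (K0 : (0 <= K)%R).
Hypothesis codim : forall (x : X) (r : R), bdry Om x -> (0 < r)%R ->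
  nu (ball x r `&` bdry Om) <= (K * r `^ (- theta))%:E * mu (ball x r `&` Om).

Let C0 : (0 <= C)%R. Proof. exact: le_trans C1. Qed.

Let bdryO : bdry Om `<=` closure Om. Proof. by move=> x []. Qed.

(** The balls containing a given [y] have their centers within [2 * rho] of [y], so [separated_card]
    with [m = 1] bounds their number by [C ^+ 4]. *)
Lemma net_overlap (rho : R) n (z : nat -> X) (f : X -> \bar R) :
  (0 < rho)%R -> (forall i, (i < n)%N -> bdry Om (z i)) -> separated rho n z ->
  mmeasurable mu Om f -> (forall x, Om x -> 0 <= f x) ->
  \sum_(i < n) \int[meas mu]_(x in ball (z i) (2 * rho) `&` Om) f x <=
    (C ^+ 4)%:E * \int[meas mu]_(x in Om) f x.
Proof.
move=> rho0 zE zsep mf f0; have mO := open_cara mu_regular Om_open.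
have mB i : mu.-cara.-measurable (ball (z i) (2 * rho) `&` Om) by exact: ballOm_cara.
have mfB i : measurable_fun (Om : set (caratheodory_type mu))
    (f \_ (ball (z i) (2 * rho))).
  apply/(@measurable_restrict _ _ (caratheodory_type mu) _ _ Om) => //.
    exact: ball_cara.
  by apply: measurable_funS mf => //; exact: ball_cara.
under eq_bigr => i _ do rewrite setIC integral_mkcondr.
rewrite -ge0_integral_sum//; last first.
  by move=> i x Ox; rewrite patchE; case: ifP => // _; exact: f0.
rewrite -ge0_integralZl_EFin ?exprn_ge0//; apply: ge0_le_integral => //.
- move=> x Ox; apply: sume_ge0 => i _.
  by rewrite patchE; case: ifP => // _; exact: f0.
- exact: emeasurable_sum.
- exact: measurable_funeM.
move=> y Oy; under eq_bigr => i _ do rewrite patchE.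
pose P := [pred i : 'I_n | `[< ball (z i) (2 * rho) y >]].
have PC : (#|P|%:R <= C ^+ 4 :> R)%R.
  apply: (@separated_card _ _ _ _ mu_regular Om_open mu_ball_Om _ C1 doubling
    1 n y rho (z \o val)) => //.
  - exact: subset_closure.
  - by move=> i _; exact: (bdryO (zE _ (ltn_ord i))).
  - by move=> i j _ _; rewrite -val_eqE; exact: (zsep i j (ltn_ord i) (ltn_ord j)).
  - by move=> i /asboolP; rewrite expr1; exact: ball_sym.
apply: (@le_trans _ _ ((#|P|%:R)%:E * f y)); last first.
  by rewrite lee_wpmul2r ?lee_fin ?f0.
rewrite (eq_bigr (fun i => if P i then f y else 0)); last first.
  by move=> i _; congr (if _ then _ else _);
    apply/idP/idP => [/set_mem/asboolP|/asboolP/mem_set].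
have -> : (#|P|%:R)%:E = \sum_(i < n | P i) 1%:E :> \bar R by rewrite sumEFin sumr_const.
by rewrite ge0_sume_distrl// -big_mkcond; apply: lee_sum => i _; rewrite mul1e.
Qed.

(* The average over [ball z rho] is controlled by the average over the ball of
   twice the radius about a nearby point of a maximal separated family; this
   majorant is measurable in [z], and bounded overlap replaces Fubini's theorem
   in its integration. *)
Lemma net_average (rho : R) (f : X -> \bar R) : (0 < rho)%R ->
  mmeasurable mu Om f -> (forall x, Om x -> 0 <= f x) ->
  exists A : X -> \bar R, [/\ mmeasurable nu (bdry Om) A, forall x, 0 <= A x,
    (forall x, bdry Om x -> avg mu (ball x rho `&` Om) f <= A x) &
    \int[meas nu]_(x in bdry Om) A x <=
      (C ^+ 6 * K * rho `^ (- theta))%:E * \int[meas mu]_(x in Om) f x].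
Proof.
move=> rho0 mf f0; have rho2 : (0 < 2 * rho)%R by rewrite mulr_gt0.
have [n [z [zE zsep zcover]]] := maximal_net mu_regular Om_open mu_ball_Om C1
  doubling Om_bounded Om_neq0 bdryO rho0.
pose B i := ball (z i) (2 * rho) `&` Om.
have mO := open_cara mu_regular Om_open.
have mB i : mu.-cara.-measurable (B i) by exact: ballOm_cara.
have fB0 i x : B i x -> 0 <= f x by move=> [_]; exact: f0.
have mfB i : mmeasurable mu (B i) f by apply: measurable_funS mf => //; exact: subIsetr.
(* If [x] is within [rho] of [z i], then [B i] lies in the ball of radius [4 * rho] about [x]: two
   doublings, hence the factor [C ^+ 2]. *)
pose c i := (C ^+ 2)%:E * avg mu (B i) f.
have c0 i : 0 <= c i.
  by apply: mule_ge0; [rewrite lee_fin exprn_ge0|exact/avg_ge0/fB0].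
pose term i x : \bar R := (\1_(ball (z i) rho) x)%:E * c i.
have term0 i x : 0 <= term i x by rewrite mule_ge0// lee_fin.
have mterm i : measurable_fun (bdry Om : set (caratheodory_type nu)) (term i).
  apply: emeasurable_funM; last exact: measurable_cst.
  by apply/measurable_EFinP/measurable_indic; exact: ball_cara.
exists (fun x => \sum_(i < n) term i x); split.
- exact: emeasurable_sum.
- by move=> x; exact: sume_ge0.
- move=> x Ex; have [i i_n zix] := zcover x Ex.
  rewrite (bigD1 (Ordinal i_n))//= -[leLHS]adde0 leeD ?sume_ge0//.
  rewrite /term indicE mem_set// mul1e; apply: avg_subset => //.
  + exact: ballOm_cara.
  + move=> w [xw Ow]; split => //; have := ball_triangle zix xw.
    by apply: le_ball; lra.
  + by case/andP: (mu_ball_Om (bdryO Ex) rho0).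
  + by case/andP: (mu_ball_Om (bdryO (zE _ i_n)) rho2).
  + apply: le_trans (doubling_iter C1 doubling 2 (bdryO Ex) rho0).
    apply: le_outer_measure => w [zw Ow]; split => //.
    by have := ball_triangle (ball_sym zix) zw; apply: le_ball; lra.
  + exact: fB0.
rewrite (_ : (C ^+ 6 * K * rho `^ (- theta))%:E * _ =
  (C ^+ 2 * (K * rho `^ (- theta)))%:E *
    ((C ^+ 4)%:E * \int[meas mu]_(x in Om) f x)); last first.
  by rewrite muleA -EFinM; congr (_%:E * _); ring.
have h0 : (0 <= C ^+ 2 * (K * rho `^ (- theta)))%R.
  by rewrite mulr_ge0 ?exprn_ge0// mulr_ge0// powR_ge0.
rewrite ge0_integral_sum//; last exact: bdry_cara.
apply: le_trans (lee_wpmul2l _ (net_overlap rho0 zE zsep mf f0)); last first.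
  by rewrite lee_fin.
rewrite ge0_sume_distrr; last by move=> i _; exact/integral_ge0/fB0.
apply: lee_sum => i _.
rewrite ge0_integralZr//; last 2 first.
- exact: bdry_cara.
- by apply/measurable_EFinP/measurable_indic; exact: ball_cara.
rewrite integral_indic; [|exact: bdry_cara|exact: ball_cara].
have zi := zE i (ltn_ord i).
have Bi0 := mu_ball_Om (bdryO zi) rho2.
have Bifin : mu (B i) \is a fin_num by rewrite ge0_fin_numE ?ltW//; case/andP: Bi0.
have vB0 : (0 < fine (mu (B i)))%R by exact: fine_gt0.
(* The codimension condition produces the factor [mu (B i)], which cancels the normalization of the
   average in [c i]. *)
apply: (@le_trans _ _ ((K * rho `^ (- theta) * fine (mu (B i)))%:E * c i)).
  rewrite lee_wpmul2r// (le_trans (codim zi rho0))// [leRHS]EFinM fineK//.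
  rewrite lee_wpmul2l ?lee_fin ?mulr_ge0 ?powR_ge0//.
  apply: le_outer_measure; apply: setSI; apply: le_ball; lra.
rewrite /c /avg !muleA -!EFinM; apply: lee_wpmul2r.
  exact/integral_ge0/fB0.
rewrite lee_fin le_eqVlt; apply/orP; left; apply/eqP; field.
by rewrite gt_eqF.
Qed.

End trace_of_averages.

(** * Summing the estimates over all scales *)

Lemma geometric_nneseries {R : realType} (c x : R) : (0 <= c)%R ->
  (0 <= x < 1)%R ->
  \sum_(0 <= k <oo) (c * x ^+ k)%:E = (c / (1 - x))%:E.
Proof.
move=> c0 /andP[x0 x1]; apply/cvg_lim => //.
have := @cvg_geometric_series R c x; rewrite ger0_norm// => /(_ x1) cvgS.
rewrite (_ : (fun n => _) = EFin \o series (geometric c x)); last first.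
  by apply/funext => n; rewrite /series/= sumEFin.
by apply: cvg_EFin => //; exact: nearW.
Qed.

Section modular_estimate.
Context {R : realType} {X : completeMetricType R}.
Variables (mu nu : {outer_measure set X -> \bar R}) (Om : set X).
Hypotheses (mu_regular : borel_regular mu) (nu_regular : borel_regular nu).
Hypothesis Om_open : open Om.
Hypothesis Om_bounded : metric_bounded Om.
Hypothesis Om_neq0 : Om !=set0.
Hypothesis mu_ball_Om : forall (x : X) (r : R), closure Om x -> (0 < r)%R ->
  0 < mu (ball x r `&` Om) < +oo.
Variables (C : R) (C1 : (1 <= C)%R).
Hypothesis doubling : forall (x : X) (r : R), closure Om x -> (0 < r)%R ->
  mu (ball x (2 * r) `&` Om) <= C%:E * mu (ball x r `&` Om).
Variables (theta K : R) (theta_lt1 : (theta < 1)%R) (K0 : (0 <= K)%R).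
Hypothesis codim : forall (x : X) (r : R), bdry Om x -> (0 < r)%R ->
  nu (ball x r `&` bdry Om) <= (K * r `^ (- theta))%:E * mu (ball x r `&` Om).
Variables (p q a : X -> R).
Hypothesis pqa : forall x, closure Om x ->
  [/\ (1 < p x)%R, (1 < q x)%R & (0 <= a x)%R].
Hypotheses (mp : mmeasurable mu Om (EFin \o p)) (mq : mmeasurable mu Om (EFin \o q)).
Hypothesis ma : mmeasurable mu Om (EFin \o a).
Variables (c R0 : R) (c0 : (0 < c)%R).
Hypothesis comparable : forall (z : X) (r : R), (0 < r)%R -> (r < R0)%R ->
  forall x y : X, (ball z r `&` closure Om) x -> (ball z r `&` closure Om) y ->
  forall xi : R, (0 <= xi)%R ->
    dphase p q a x xi%:E <= c%:E * dphase p q a y (c * xi)%:E.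
Variables (rho : R) (rho_gt0 : (0 < rho)%R) (rho_lt : (rho < R0)%R).

(** The weights sum to 1 and are proportional to the radii, as is the factor in front of the average
    in the Poincare inequality. *)
Definition multiscale (F : nat -> X -> \bar R) (z : X) : \bar R :=
  \sum_(0 <= k <oo) (2^-1 * 2^-1 ^+ k)%:E *
    avg mu (ball z (2^-1 ^+ k * rho) `&` Om) (F k).

(** At scale [k] comparability replaces the exponents at [z] by those at the variable of
    integration, and [net_average] then supplies a measurable majorant; [A] is the weighted sum of
    these. [M] is fixed before [F] and [E], which makes the later bounds uniform in [u]. *)
Lemma modular_estimate : exists2 M : R, (0 <= M)%R &
  forall (F : nat -> X -> \bar R) (E : R),
  (forall k, mmeasurable mu Om (F k)) -> (forall k x, Om x -> 0 <= F k x) ->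
  (forall k, \int[meas mu]_(x in Om) dphase p q a x (c%:E * F k x) <= E%:E) ->
  exists A : X -> \bar R, [/\ mmeasurable nu (bdry Om) A, forall x, 0 <= A x,
    \int[meas nu]_(x in bdry Om) A x <= (M * E)%:E &
    forall z (s : R), bdry Om z -> (0 <= s)%R ->
      multiscale F z * dphase p q a z s%:E <=
        s%:E * A z + s%:E * dphase p q a z s%:E].
Proof.
pose w k : R := (2^-1 * 2^-1 ^+ k)%R.
have w0 k : (0 <= w k)%R by rewrite mulr_ge0// exprn_ge0.
have w1 : \sum_(0 <= k <oo) (w k)%:E = 1.
  rewrite geometric_nneseries//; last by apply/andP; split => //; lra.
  by have -> : (1 - 2^-1 = 2^-1 :> R)%R; [lra|rewrite divff].
pose r k : R := (2^-1 ^+ k * rho)%R.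
have r0 k : (0 < r k)%R by rewrite mulr_gt0// exprn_gt0.
have rR0 k : (r k < R0)%R.
  by apply: le_lt_trans rho_lt; rewrite ler_piMl ?(ltW rho_gt0)// exprn_ile1//; lra.
(* The ratio of the final geometric series: halving the radius costs 2 to the power [theta] and the
   weight gains 1/2. It is below 1 since [theta < 1]. *)
pose x : R := (2^-1 `^ (- theta) / 2)%R.
have x0 : (0 <= x)%R by rewrite divr_ge0// powR_ge0.
have x1 : (x < 1)%R.
  rewrite ltr_pdivrMr// mul1r /powR gt_eqF// lnV ?posrE// mulrNN.
  rewrite -[X in (_ < X)%R](@lnK _ 2%R) ?posrE// ltr_expR -[X in (_ < X)%R]mul1r.
  by rewrite ltr_pM2r// ln_gt0// ltr1n.
have wr k : (w k * r k `^ (- theta) = 2^-1 * rho `^ (- theta) * x ^+ k)%R.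
  rewrite /r powRM ?exprn_ge0 ?(ltW rho_gt0)// /w /x expr_div_n -exprVn.
  rewrite -[in LHS](@powR_mulrn _ _ k) ?invr_ge0//.
  by rewrite powRAC !powR_mulrn ?powR_ge0 ?invr_ge0//; ring.
(* [H * x ^+ k] is the weight at scale [k] times [c] times the constant of [net_average] at radius
   [r k]. *)
pose H := (c * (C ^+ 6 * K) * (2^-1 * rho `^ (- theta)))%R.
have H0 : (0 <= H)%R.
  by rewrite !mulr_ge0 ?powR_ge0 ?exprn_ge0 ?(ltW c0)// (le_trans ler01).
exists (H / (1 - x))%R; first by rewrite divr_ge0// subr_ge0 ltW.
move=> F E mF F0 FE.
have mO := open_cara mu_regular Om_open.
have cF0 k y : Om y -> 0 <= c%:E * F k y.
  by move=> Oy; rewrite mule_ge0 ?F0// lee_fin ltW.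
have pqaO y : Om y -> [/\ (1 < p y)%R, (1 < q y)%R & (0 <= a y)%R].
  by move=> /subset_closure; exact: pqa.
pose f k y := dphase p q a y (c%:E * F k y).
have mf k : mmeasurable mu Om (f k).
  apply: mmeasurable_dphase => //; first by move=> y /pqaO[].
    exact: cF0.
  by apply: measurable_funeM; exact: mF.
have f0 k y : Om y -> 0 <= f k y by move=> /pqaO[? ? ?]; exact: dphase_ge0.
have E0 : (0 <= E)%R by rewrite -lee_fin; apply: le_trans (FE 0%N); exact/integral_ge0/(f0 0%N).
have bdryO : bdry Om `<=` closure Om by move=> y [].
have /choice[A HA] k := net_average mu_regular nu_regular Om_open Om_bounded
  Om_neq0 mu_ball_Om C1 doubling K0 codim (r0 k) (mf k) (f0 k).
pose B k z := (w k * c)%:E * A k z.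
have B0 k z : 0 <= B k z.
  by have [_ A0 _ _] := HA k; rewrite mule_ge0// lee_fin mulr_ge0// ltW.
have mB k : mmeasurable nu (bdry Om) (B k).
  by have [mA _ _ _] := HA k; exact: measurable_funeM.
have mE := bdry_cara nu_regular Om.
exists (fun z => \sum_(0 <= k <oo) B k z); split.
- apply: (@ge0_emeasurable_sum _ (caratheodory_type nu) _ _ B xpredT) => k *.
  + exact: B0.
  + exact: mB.
- by move=> z; exact: nneseries_ge0.
- rewrite integral_nneseries//.
  rewrite -[leRHS]/((H / (1 - x) * E)%:E) mulrAC -geometric_nneseries//; last 2 first.
  + by rewrite mulr_ge0.
  + by rewrite x0.
  apply: lee_nneseries => k _; first by move=> _; exact: integral_ge0.
  have [mA A0 _ AE] := HA k.
  rewrite ge0_integralZl_EFin// ?mulr_ge0 ?(ltW c0)//.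
  apply: (le_trans (lee_wpmul2l _ (le_trans AE (lee_wpmul2l _ (FE k))))).
  + by rewrite lee_fin mulr_ge0// ltW.
  + by rewrite lee_fin !mulr_ge0 ?powR_ge0 ?exprn_ge0// (le_trans ler01).
  rewrite -!EFinM lee_fin le_eqVlt; apply/orP; left; apply/eqP.
  rewrite (_ : H * E * x ^+ k = c * (C ^+ 6 * K) * E * (2^-1 * rho `^ (- theta) * x ^+ k))%R.
    by rewrite -wr; ring.
  by rewrite /H; ring.
move=> z s Ez s0; have [pz qz az] := pqa (bdryO _ Ez).
set phi := dphase p q a z s%:E.
have phi0 : 0 <= phi by exact: dphase_ge0.
have [t [t0 phiE]] : exists t : R, (0 <= t)%R /\ phi = t%:E.
  exists (fine phi); split; first exact: fine_ge0.
  by rewrite /phi dphase_EFin.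
have avg0 k : 0 <= avg mu (ball z (r k) `&` Om) (F k).
  by apply: avg_ge0 => y [_]; exact: F0.
rewrite phiE muleC /multiscale -nneseriesZl; last first.
  by move=> k _; rewrite mule_ge0// ?lee_fin// avg0.
(* As the weights sum to 1, the extra term is distributed over the scales, and the inequality can be
   checked scale by scale. *)
have -> : s%:E * (\sum_(0 <= k <oo) B k z) + s%:E * t%:E =
    \sum_(0 <= k <oo) (s%:E * B k z + (s * t)%:E * (w k)%:E).
  rewrite nneseriesD; last 2 first.
  + by move=> k _; rewrite mule_ge0.
  + by move=> k _; rewrite -EFinM lee_fin !mulr_ge0.
  rewrite (nneseriesZl _ _ (fun k _ => B0 k z)).
  rewrite (@nneseriesZl _ (fun k => (w k)%:E)) => [|k _]; last by rewrite lee_fin.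
  by rewrite w1 mule1 EFinM.
apply: lee_nneseries => k _.
  move=> _; apply: mule_ge0; first by rewrite lee_fin.
  by apply: mule_ge0; [rewrite lee_fin; exact: w0|exact: avg0].
have [_ A0 Aavg _] := HA k.
have mD := ballOm_cara mu_regular Om_open z (r k).
have DO : ball z (r k) `&` Om `<=` Om by exact: subIsetr.
have mDS g : mmeasurable mu Om g -> mmeasurable mu (ball z (r k) `&` Om) g.
  by move=> mg; exact: measurable_funS mg.
have D0 := mu_ball_Om (bdryO _ Ez) (r0 k).
have FD0 y : (ball z (r k) `&` Om) y -> 0 <= F k y by move=> [_]; exact: F0.
have tang := avg_dphase_tangent mD D0 pz qz az FD0 (mDS _ (mF k)) s0.
have comp := @avg_dphase_comparable _ _ p q a _ _ mD z pz qz az _ FD0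
  (mDS _ (mF k)) c c0 (mDS _ mp) (mDS _ mq) (mDS _ ma).
have {comp} : avg mu (ball z (r k) `&` Om) (fun y => dphase p q a z (F k y)) <=
    c%:E * A k z.
  apply: le_trans (comp _ _) _.
  - by move=> y [_]; exact: pqaO.
  - move=> y v [zy Oy] v0; apply: (comparable (r0 k) (rR0 k)) => //.
    + by split; [exact: ballxx|exact: bdryO].
    + by split => //; exact: subset_closure.
  - by rewrite lee_wpmul2l ?lee_fin ?(ltW c0)// Aavg.
move=> comp; move: tang; rewrite -/phi phiE => tang.
rewrite muleCA (le_trans (lee_wpmul2l _ (_ : _ <= s%:E * (c%:E * A k z) + s%:E * t%:E)))//.
  by rewrite muleC (le_trans tang)// leeD2r// lee_wpmul2l// lee_fin.
rewrite ge0_muleDr; last 2 first.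
- by rewrite !mule_ge0// lee_fin ltW.
- by rewrite mule_ge0// lee_fin.
rewrite -/(w k) /B; move: (w k) (A k z) => v y.
have -> : (v * c)%:E = v%:E * c%:E by [].
rewrite [v%:E * (s%:E * (_ * _))]muleCA [v%:E * (c%:E * _)]muleA.
by rewrite [v%:E * (s%:E * _)]muleC.
Qed.

End modular_estimate.

(** * Convergence of ball averages *)

Lemma cvg_summable_increments {R : realType} (v e : R^nat) :
  (forall k, `|v k.+1 - v k| <= e k)%R -> \sum_(0 <= k <oo) (e k)%:E < +oo ->
  exists2 t : R, v n @[n --> \oo] --> t &
    (`|t|)%:E <= (`|v 0%N|)%:E + \sum_(0 <= k <oo) (e k)%:E.
Proof.
move=> ve esum.
have e0 k : (0 <= e k)%R by apply: le_trans (ve k).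
have ee0 k : 0 <= (e k)%:E by rewrite lee_fin.
have Sfin : \sum_(0 <= k <oo) (e k)%:E \is a fin_num.
  by rewrite ge0_fin_numE// nneseries_ge0.
rewrite -(fineK Sfin); set S := fine _.
have partial n : (series e n <= S)%R.
  rewrite -lee_fin fineK// /series/= -sumEFin.
  exact: (nneseries_lim_ge _ (fun k _ _ => ee0 k)).
have ecvg : cvgn (series e).
  apply: nondecreasing_is_cvgn; first exact: nondecreasing_series.
  by exists S => _ [n _ <-].
have tcvg : cvgn (series (telescope v)).
  apply: normed_cvg; by apply: (@series_le_cvg _ _ e) => // k; exact: normr_ge0.
have /cvg_ex[l vl] : cvgn v.
  have -> : v = (fun n => v 0%N + series (telescope v) n)%R.
    by apply/funext => n; rewrite telescopeK addrC subrK.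
  exact: is_cvgD (is_cvg_cst _) tcvg.
exists l => //; rewrite -EFinD lee_fin.
have vn n : (`|v n| <= `|v 0%N| + S)%R.
  apply: (@le_trans _ _ (`|v 0%N| + series e n)%R); last by rewrite lerD2l.
  elim: n => [|n ih]; first by rewrite /series/= big_geq// addr0.
  rewrite -[X in (`|X| <= _)%R](subrK (v n)) (le_trans (ler_normD _ _))//.
  by rewrite seriesS [leRHS]addrCA lerD.
by apply: (cvgr_to_le (cvg_norm vl)); exact: nearW.
Qed.

(** For a nonnegative function an eventual real upper bound also gives the eventual finiteness that
    [fine_cvgP] asks for. *)
Lemma cvge0P {R : realType} {T : Type} (F : set_system T) {FF : Filter F}
    (f : T -> \bar R) : (forall x, 0 <= f x) ->
  f x @[x --> F] --> 0 <-> forall e : R, (0 < e)%R -> \forall x \near F, f x <= e%:E.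
Proof.
move=> f0; split => [/fine_cvgP[ffin /cvgr0Pnorm_le cf] e e0|cf].
  apply: filterS2 ffin (cf _ e0) => x fx /=.
  by rewrite ger0_norm ?fine_ge0// -lee_fin fineK.
apply/fine_cvgP; split.
  by apply: filterS (cf _ ltr01) => x fx; rewrite ge0_fin_numE// (le_lt_trans fx) ?ltry.
apply/cvgr0Pnorm_le => e e0; apply: filterS (cf _ e0) => x fx /=.
rewrite ger0_norm ?fine_ge0// -lee_fin fineK//.
by rewrite ge0_fin_numE// (le_lt_trans fx) ?ltry.
Qed.

Lemma abse_sub_triangle {R : realType} (x : \bar R) (s t : R) :
  `|x - t%:E| <= `|x - s%:E| + (`|s - t|)%:E.
Proof.
case: x => [x| |] //=.
by rewrite -EFinD lee_fin ler_distD.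
Qed.

(** * Mean distance of a function to a constant *)

Section mean_oscillation.
Context {R : realType} {X : completeMetricType R}.
Variables (m : {outer_measure set X -> \bar R}).
Variables (A : set X) (mA : m.-cara.-measurable A) (A0 : 0 < m A < +oo).
Variable u : X -> \bar R.

Lemma mmeasurable_dist (t : R) : mmeasurable m A u ->
  mmeasurable m A (fun y => `|u y - t%:E|).
Proof.
by move=> mu; apply: measurableT_comp => //; exact: emeasurable_funB.
Qed.

Hypothesis iu : (meas m).-integrable A u.

Let mu : mmeasurable m A u. Proof. exact: measurable_int iu. Qed.

Lemma avg_fin_num : avg m A u \is a fin_num.
Proof. by rewrite fin_numM// integrable_fin_num. Qed.

Lemma le_abse_avg : `|avg m A u| <= avg m A (fun y => `|u y|).
Proof.
rewrite /avg abseM gee0_abs ?lee_fin ?invr_ge0 ?fine_ge0//.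
by rewrite lee_wpmul2l ?lee_fin ?invr_ge0 ?fine_ge0// le_abse_integral.
Qed.

End mean_oscillation.

Section mean_oscillation_bounds.
Context {R : realType} {X : completeMetricType R}.
Variables (m : {outer_measure set X -> \bar R}).
Variables (A : set X) (mA : m.-cara.-measurable A) (A0 : 0 < m A < +oo).
Variable u : X -> \bar R.

Lemma avg_dist_triangle (s t : R) : mmeasurable m A u ->
  avg m A (fun y => `|u y - t%:E|) <=
    avg m A (fun y => `|u y - s%:E|) + (`|s - t|)%:E.
Proof.
move=> mu; rewrite -(avg_cst (`|s - t|)%R mA A0) -avgD//; last 3 first.
- by move=> x _; rewrite lee_fin.
- exact: mmeasurable_dist.
- exact: measurable_cst.
apply: le_avg => //.
- exact: mmeasurable_dist.
- by apply: emeasurable_funD; [exact: mmeasurable_dist|exact: measurable_cst].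
- by move=> x Ax; exact: abse_sub_triangle.
Qed.

(** The constant [|s - t|] is its own average. Hence two numbers to which [u] converges in mean
    coincide. *)
Lemma avg_dist_unique (s t : R) : mmeasurable m A u ->
  (`|s - t|)%:E <=
    avg m A (fun y => `|u y - s%:E|) + avg m A (fun y => `|u y - t%:E|).
Proof.
move=> mu; rewrite -(avg_cst (`|s - t|)%R mA A0) -avgD//; try exact: mmeasurable_dist.
apply: le_avg => //.
- by move=> x Ax; rewrite lee_fin.
- exact: measurable_cst.
- by apply: emeasurable_funD; exact: mmeasurable_dist.
- move=> x Ax /=; case: (u x) => [y| |] /=; rewrite ?leey//.
  by rewrite -EFinD lee_fin (distrC y s) ler_distD.
Qed.

Lemma dist_avg_le (t : R) : (meas m).-integrable A u ->
  `|avg m A u - t%:E| <= avg m A (fun y => `|u y - t%:E|).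
Proof.
move=> iu; have it : (meas m).-integrable A (cst t%:E).
  apply/integrableP; split; first exact: measurable_cst.
  by rewrite integral_cst//= lte_mul_pinfty//; case/andP: A0.
have -> : avg m A u - t%:E = avg m A (fun y => u y - t%:E).
  rewrite -[t%:E in LHS](avg_cst t mA A0) /avg integralB// [RHS]muleBr//.
  by apply: fin_num_adde_defr; exact: integrable_fin_num.
by apply: le_abse_avg => //; exact: integrableB.
Qed.

End mean_oscillation_bounds.

Section ball_average_limit.
Context {R : realType} {X : completeMetricType R}.
Variables (mu : {outer_measure set X -> \bar R}) (Om : set X).
Hypothesis mu_regular : borel_regular mu.
Hypothesis Om_open : open Om.
Hypothesis mu_ball_Om : forall (x : X) (r : R), closure Om x -> (0 < r)%R ->
  0 < mu (ball x r `&` Om) < +oo.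
Variables (C : R) (C1 : (1 <= C)%R).
Hypothesis doubling : forall (x : X) (r : R), closure Om x -> (0 < r)%R ->
  mu (ball x (2 * r) `&` Om) <= C%:E * mu (ball x r `&` Om).

Lemma ball_average_unique (u : X -> \bar R) (z : X) (s t : R) :
  closure Om z -> mmeasurable mu Om u ->
  avg mu (ball z r `&` Om) (fun y => `|u y - s%:E|) @[r --> 0^'+] --> 0 ->
  avg mu (ball z r `&` Om) (fun y => `|u y - t%:E|) @[r --> 0^'+] --> 0 ->
  s = t.
Proof.
move=> Oz um us ut; apply/eqP; rewrite -subr_eq0 -normr_le0; apply/ler_addgt0Pl => e e0.
rewrite addr0.
have avg0 (w : R) r : 0 <= avg mu (ball z r `&` Om) (fun y => `|u y - w%:E|).
  by apply: avg_ge0 => y _; exact: abse_ge0.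
move/(cvge0P (avg0 s)) : us => /(_ (e / 2)%R); rewrite divr_gt0// => /(_ isT) us.
move/(cvge0P (avg0 t)) : ut => /(_ (e / 2)%R); rewrite divr_gt0// => /(_ isT) ut.
near (0 : R)^'+ => r.
have r0 : (0 < r)%R by near: r; exact: nbhs_right_gt.
rewrite -lee_fin [e]splitr EFinD.
have mB := ballOm_cara mu_regular Om_open z r.
apply: le_trans (avg_dist_unique mB (mu_ball_Om Oz r0) s t _) _.
  by apply: measurable_funS um => //; exact: open_cara.
by apply: leeD; near: r.
Unshelve. all: by end_near. Qed.

Variables (u : X -> \bar R) (iu : (meas mu).-integrable Om u).
Variables (z : X) (Oz : closure Om z) (rho : R) (rho0 : (0 < rho)%R).
Variable e : R^nat.
Let r k : R := (2^-1 ^+ k * rho)%R.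
Let B t := ball z t `&` Om.
Hypothesis oscillation : forall k,
  avg mu (B (r k)) (fun y => `|u y - avg mu (B (r k)) u|) <= (e k)%:E.
Hypothesis summable : \sum_(0 <= k <oo) (e k)%:E < +oo.

Let r0 k : (0 < r k)%R. Proof. by rewrite mulr_gt0// exprn_gt0. Qed.
Let rS k : r k = (2 * r k.+1)%R.
Proof. by rewrite /r exprS !mulrA divff// mul1r. Qed.
Let mB t : mu.-cara.-measurable (B t). Proof. exact: ballOm_cara. Qed.
Let iB t : (meas mu).-integrable (B t) u.
Proof. by apply: integrableS iu => //; [exact: open_cara|exact: subIsetr]. Qed.
Let mu_u t : mmeasurable mu (B t) u. Proof. exact: measurable_int (iB t). Qed.
Let B0 t : (0 < t)%R -> 0 < mu (B t) < +oo. Proof. exact: mu_ball_Om. Qed.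
Let v k : R := fine (avg mu (B (r k)) u).
Let vE k : avg mu (B (r k)) u = (v k)%:E.
Proof. by rewrite fineK//; exact: avg_fin_num. Qed.

Lemma avg_ball_half (s t : R) (w : R) : (0 < s)%R -> (s <= t)%R -> (t <= 2 * s)%R ->
  avg mu (B s) (fun y => `|u y - w%:E|) <=
    C%:E * avg mu (B t) (fun y => `|u y - w%:E|).
Proof.
move=> s0 st ts; have t0 : (0 < t)%R by exact: lt_le_trans st.
apply: avg_subset => //.
- by apply: setSI; exact: le_ball.
- by case/andP: (B0 s0).
- by case/andP: (B0 t0).
- apply: le_trans (doubling Oz s0); apply: le_outer_measure.
  by apply: setSI; exact: le_ball.
- exact: mmeasurable_dist.
Qed.

(** The average [v k.+1] differs from [v k] by at most the mean of [|u - v k|] over the smaller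
    ball, which doubling bounds by [C * e k]; so [v] converges to some [t]. On the ball of radius
    [r k] the mean of [|u - t|] is at most [e k + |v k - t|], and doubling fills in the radii
    between. *)
Lemma ball_average_limit : exists t : R,
  [/\ fine (avg mu (B (r k)) u) @[k --> \oo] --> t,
      (`|t|)%:E <= avg mu (B (r 0%N)) (fun y => `|u y|) +
        C%:E * \sum_(0 <= k <oo) (e k)%:E &
      avg mu (B s) (fun y => `|u y - t%:E|) @[s --> 0^'+] --> 0].
Proof.
have C0 : (0 < C)%R by exact: lt_le_trans C1.
have osc k : avg mu (B (r k)) (fun y => `|u y - (v k)%:E|) <= (e k)%:E.
  by rewrite -vE; exact: oscillation.
have e0 k : 0 <= (e k)%:E by apply: le_trans (osc k); exact: avg_ge0.
have CE : \sum_(0 <= k <oo) (C * e k)%:E = C%:E * \sum_(0 <= k <oo) (e k)%:E.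
  by rewrite -nneseriesZl// => k _; exact: e0.
have [t vt tle] : exists2 t : R, v n @[n --> \oo] --> t &
    (`|t|)%:E <= (`|v 0%N|)%:E + \sum_(0 <= k <oo) (C * e k)%:E.
  apply: cvg_summable_increments => [k|]; last first.
    by rewrite CE lte_mul_pinfty// ltW.
  rewrite -lee_fin -[(_ - _)%R]/(v k.+1 - v k)%R EFinM.
  apply: (@le_trans _ _ (avg mu (B (r k.+1)) (fun y => `|u y - (v k)%:E|))).
    by have := dist_avg_le (mB _) (B0 (r0 k.+1)) (v k) (iB _); rewrite vE.
  apply: le_trans (lee_wpmul2l _ (osc k)); last by rewrite lee_fin ltW.
  by apply: avg_ball_half => //; rewrite (rS k); have := r0 k.+1; lra.
exists t; split => //.
  rewrite -CE (le_trans tle)// leeD2r//.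
  by have := le_abse_avg (mB (r 0%N)) (iB _); rewrite vE.
apply/cvge0P => [s|eps eps0]; first by apply: avg_ge0 => y _; exact: abse_ge0.
have ecvg0 : e k @[k --> \oo] --> (0 : R)%R.
  apply: cvg_series_cvg_0; apply: nondecreasing_is_cvgn.
    by apply: nondecreasing_series => k _ _; rewrite -lee_fin.
  exists (fine (\sum_(0 <= k <oo) (e k)%:E)) => _ [n _ <-].
  rewrite -lee_fin fineK; last by rewrite ge0_fin_numE// nneseries_ge0.
  by rewrite /series/= -sumEFin; exact: (nneseries_lim_ge _ (fun k _ _ => e0 k)).
(* The tolerance [eps / C] makes up for the factor [C] lost in passing from radius [s] to a dyadic
   radius. *)
have /cvgrPdist_le/(_ _ (divr_gt0 eps0 C0)) : (e k + `|v k - t|)%R @[k --> \oo] --> (0 : R)%R.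
  rewrite -[X in _ --> X](addr0 0%R); apply: cvgD => //.
  by rewrite -(normr0 R) -(subrr t); apply: cvg_norm; apply: cvgB => //; exact: cvg_cst.
move=> [N _ small].
near=> s.
have s0 : (0 < s)%R by near: s; exact: nbhs_right_gt.
have sN : (s <= r N)%R by near: s; exact: nbhs_right_le.
have [n rn] : exists n, (r n < s)%R.
  exists (Num.Def.archi_bound (rho / s)%R).
  rewrite /r exprVn mulrC ltr_pdivrMr ?exprn_gt0// mulrC -ltr_pdivrMr//.
  exact: upper_nthrootP.
(* [r m] is the first dyadic radius below [s]. As [s <= r N], [m] exceeds [N], so [m = k.+1] with
   [N <= k] and [r k.+1 < s <= r k]. *)
have [m rm mmin] := ex_minnP (ex_intro (fun n => r n < s)%R n rn).
have Nm : (N < m)%N.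
  rewrite ltnNge; apply/negP => mN; move: (lt_le_trans rm sN); rewrite ltNge.
  by rewrite /r ler_pM2r// ler_wiXn2l//; lra.
case: m => [|k] in rm mmin Nm *; first by [].
have srk : (s <= r k)%R.
  by rewrite leNgt; apply/negP => /mmin; rewrite ltnn.
apply: (le_trans (avg_ball_half t s0 srk _)).
  by rewrite (rS k) ler_pM2l// ltW.
rewrite -lee_pdivlMl//; apply: le_trans (avg_dist_triangle _ _ (v k) _ _) _ => //.
- exact: B0.
have := small k Nm; rewrite /= sub0r normrN ger0_norm; last by rewrite addr_ge0// -lee_fin.
rewrite -lee_fin -EFinM mulrC; apply: le_trans.
by rewrite EFinD leeD2r.
Unshelve. all: by end_near. Qed.

End ball_average_limit.

(** * Measurability of ball averages in the center *)

Section measurable_ball_average.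
Context {R : realType} {X : completeMetricType R}.
Variables (mu nu : {outer_measure set X -> \bar R}) (Om : set X).
Hypotheses (mu_regular : borel_regular mu) (nu_regular : borel_regular nu).
Hypothesis Om_open : open Om.

(* Balls being open, the integral over [ball z r] is lower semicontinuous in
   the center [z]. *)
Lemma open_ball_integral_gt (f : X -> \bar R) (r : R) (c : \bar R) :
  mmeasurable mu Om f -> (forall x, Om x -> 0 <= f x) ->
  open [set z | c < \int[meas mu]_(x in ball z r `&` Om) f x].
Proof.
move=> mf f0; rewrite openE => z /= cz.
have mB := ballOm_cara mu_regular Om_open.
have mfB w s : mmeasurable mu (ball w s `&` Om) f.
  by apply: measurable_funS mf => //; exact: open_cara.
have fB0 w s x : (ball w s `&` Om) x -> 0 <= f x by move=> [_]; exact: f0.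
pose F n := ball z (r - n.+1%:R^-1) `&` Om.
have F_lt n : c < \int[meas mu]_(x in F n) f x ->
    nbhs z [set z | c < \int[meas mu]_(x in ball z r `&` Om) f x].
  move=> cn; apply/nbhs_ballP; exists (n.+1%:R^-1)%R => /=; first by rewrite invr_gt0.
  move=> w zw /=; apply: lt_le_trans cn _; apply: ge0_subset_integral => //.
  - exact: mB.
  - exact: mfB.
  - exact: fB0.
  - move=> y [zy Oy]; split => //.
    by have := ball_triangle (ball_sym zw) zy; rewrite addrC subrK.
have [n cn] : exists n, c < \int[meas mu]_(x in F n) f x.
  apply: contrapT => /forallNP Fc; move: cz; apply/negP; rewrite -leNgt.
  have -> : ball z r `&` Om = \bigcup_n F n.
    rewrite -setI_bigcupl; congr (_ `&` _); apply/seteqP; split => y.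
      rewrite ballEmdist/= => /ltr_add_invr[k zk]; exists k => //.
      by rewrite ballEmdist/= ltrBrDr.
    by move=> [k _]; apply: le_ball; rewrite gerBl invr_ge0.
  have Fcvg : \int[meas mu]_(x in F n) f x @[n --> \oo] -->
      \int[meas mu]_(x in \bigcup_n F n) f x.
    apply: ge0_nondecreasing_set_cvg_integral => //.
    - move=> m n mn; apply/subsetPset; apply: setSI; apply: le_ball.
      by rewrite lerB// lef_pV2 ?posrE// ler_nat.
    - by move=> n; exact: mB.
    - by move=> n; exact: mfB.
    - by move=> n; exact: fB0.
  apply: (cvge_to_le Fcvg); apply: nearW => n.
  by rewrite leNgt; apply/negP; exact: Fc.
exact: F_lt cn.
Qed.

Lemma mmeasurable_ball_integral (D : set X) (f : X -> \bar R) (r : R) :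
  nu.-cara.-measurable D ->
  mmeasurable mu Om f -> (forall x, Om x -> 0 <= f x) ->
  mmeasurable nu D (fun z => \int[meas mu]_(x in ball z r `&` Om) f x).
Proof.
move=> mD mf f0; apply: (measurability _ (ErealGenOInfty.measurableE R)) => _ [_ [c ->] <-].
apply: measurableI => //.
have := open_ball_integral_gt r c%:E mf f0.
by move=> /(open_cara nu_regular); congr measurable; apply/seteqP; split => z /=;
  rewrite in_itv/= andbT.
Qed.

Lemma mmeasurable_ball_avg (D : set X) (u : X -> \bar R) (r : R) :
  nu.-cara.-measurable D -> mmeasurable mu Om u ->
  mmeasurable nu D (fun z => avg mu (ball z r `&` Om) u).
Proof.
move=> mD mu_u.
have mint (f : X -> \bar R) := @mmeasurable_ball_integral D f r mD.
apply: emeasurable_funM.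
  apply/measurable_EFinP.
  (* The measure of a set is the integral of 1 over it, so [mint] covers it as well; the inverse is
     the power -1, a measurable function. *)
  rewrite (_ : (fun z => _) = (fun z =>
      (fine (\int[meas mu]_(x in ball z r `&` Om) (cst 1 x))) `^ (-1))%R).
    apply: (measurableT_comp (measurable_powR _)); apply: measurableT_comp => //.
    by apply: mint => //; exact: measurable_cst.
  apply/funext => z; rewrite integral_cst; last exact: ballOm_cara.
  by rewrite mul1e powR_inv1// fine_ge0.
rewrite (_ : (fun z => _) = (fun z =>
  \int[meas mu]_(x in ball z r `&` Om) u^\+ x -
  \int[meas mu]_(x in ball z r `&` Om) u^\- x)).
  apply: emeasurable_funB; apply: mint => //.
  - exact: measurable_funepos.
  - exact: measurable_funeneg.
by apply/funext => z; rewrite integralE.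
Qed.

End measurable_ball_average.

(** * Modulars and Luxemburg norms *)

Section ae_cara.
Context {R : realType} {X : completeMetricType R}.
Variable m : {outer_measure set X -> \bar R}.
Implicit Types P Q : X -> Prop.

Lemma ae_cara_sub P Q : (forall x, P x -> Q x) ->
  {ae meas m, forall x, P x} -> {ae meas m, forall x, Q x}.
Proof. exact: (@filterS _ _ (ae_filter_ringOfSetsType (meas m))). Qed.

Lemma ae_cara_and P Q : {ae meas m, forall x, P x} -> {ae meas m, forall x, Q x} ->
  {ae meas m, forall x, P x /\ Q x}.
Proof. exact: (@filterI _ _ (ae_filter_ringOfSetsType (meas m))). Qed.

End ae_cara.

(** The sum is at most twice the larger term, so monotonicity suffices. *)
Lemma le_dphaseD {R : realType} {X : completeMetricType R} (p q a : X -> R) x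
    (s t : \bar R) : (1 < p x)%R -> (1 < q x)%R -> (0 <= a x)%R ->
  0 <= s -> 0 <= t ->
  dphase p q a x (s + t) <= dphase p q a x (2%:E * s) + dphase p q a x (2%:E * t).
Proof.
move=> px qx ax; wlog st : s t / s <= t => [hwlog s0 t0|s0 t0].
  have [st|/ltW ts] := leP s t; first exact: hwlog.
  by rewrite addeC [leRHS]addeC; exact: hwlog.
apply: (@le_trans _ _ (dphase p q a x (2%:E * t))).
  by apply: le_dphase => //; [exact: adde_ge0|rewrite mule_natl mule2n leeD].
by rewrite leeDr// dphase_ge0.
Qed.

Section orlicz.
Context {R : realType} {X : completeMetricType R}.
Variables (p q a : X -> R) (m : {outer_measure set X -> \bar R}) (D : set X).
Hypothesis mD : m.-cara.-measurable D.
Hypotheses (mp : mmeasurable m D (EFin \o p)) (mq : mmeasurable m D (EFin \o q)).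
Hypothesis ma : mmeasurable m D (EFin \o a).
Hypothesis pqa : forall x, D x -> [/\ (1 < p x)%R, (1 < q x)%R & (0 <= a x)%R].
Implicit Types f g : X -> \bar R.

Lemma mmeasurable_dphase_scale (c : R) f : (0 <= c)%R ->
  (forall x, D x -> 0 <= f x) -> mmeasurable m D f ->
  mmeasurable m D (fun x => dphase p q a x (c%:E * f x)).
Proof.
move=> c0 f0 mf; apply: mmeasurable_dphase => //.
- by move=> x /pqa[].
- by move=> x Dx; rewrite mule_ge0// f0.
- exact: measurable_funeM.
Qed.

Lemma dphase_scale_ge0 x s : D x -> 0 <= dphase p q a x s.
Proof. by move=> /pqa[px qx ax]; exact: dphase_ge0. Qed.

Lemma mmeasurable_abse f : mmeasurable m D f -> mmeasurable m D (fun x => `|f x|).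
Proof. by move=> mf; exact: measurableT_comp. Qed.

Lemma LH_integrable f : m D < +oo -> LH p q a m D f -> (meas m).-integrable D f.
Proof.
move=> Doo [mf foo]; apply/integrableP; split => //.
have mphi : mmeasurable m D (fun x => dphase p q a x `|f x|).
  apply: mmeasurable_dphase => //; first by move=> x /pqa[].
  exact: mmeasurable_abse.
apply: (@le_lt_trans _ _ (\int[meas m]_(x in D) (cst 1 x + dphase p q a x `|f x|))).
  apply: ge0_le_integral => //.
  - exact: mmeasurable_abse.
  - by apply: emeasurable_funD => //; exact: measurable_cst.
  - by move=> x /pqa[px qx ax]; exact: le_dphase1.
rewrite ge0_integralD//; last first.
  by move=> x; exact: dphase_scale_ge0.
by rewrite integral_cst// mul1e lte_add_pinfty.
Qed.

Lemma integral_dphaseD (b : R) f g : (0 <= b)%R ->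
  (forall x, D x -> 0 <= f x) -> (forall x, D x -> 0 <= g x) ->
  mmeasurable m D f -> mmeasurable m D g ->
  \int[meas m]_(x in D) dphase p q a x (b%:E * (f x + g x)) <=
  \int[meas m]_(x in D) dphase p q a x ((2 * b)%:E * f x) +
  \int[meas m]_(x in D) dphase p q a x ((2 * b)%:E * g x).
Proof.
move=> b0 f0 g0 mf mg; have b20 : (0 <= 2 * b)%R by rewrite mulr_ge0.
have mf2 := mmeasurable_dphase_scale b20 f0 mf.
have mg2 := mmeasurable_dphase_scale b20 g0 mg.
rewrite -ge0_integralD//; try by move=> x; exact: dphase_scale_ge0.
apply: ge0_le_integral => //.
- by move=> x; exact: dphase_scale_ge0.
- apply: mmeasurable_dphase_scale => //; last exact: emeasurable_funD.
  by move=> x Dx; rewrite adde_ge0 ?f0 ?g0.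
- exact: emeasurable_funD.
move=> x Dx; have [px qx ax] := pqa Dx.
rewrite ge0_muleDr ?f0 ?g0// EFinM -!muleA.
by apply: le_dphaseD => //; rewrite mule_ge0 ?f0 ?g0.
Qed.

Lemma integral_dphase_shrink (b : R) f : (0 <= b <= 1)%R ->
  (forall x, D x -> 0 <= f x) -> mmeasurable m D f ->
  \int[meas m]_(x in D) dphase p q a x (b%:E * f x) <=
  b%:E * \int[meas m]_(x in D) dphase p q a x (f x).
Proof.
move=> /andP[b0 b1] f0 mf.
have mphi : mmeasurable m D (fun x => dphase p q a x (f x)).
  by apply: mmeasurable_dphase => // x /pqa[].
rewrite -ge0_integralZl_EFin//; last by move=> x; exact: dphase_scale_ge0.
apply: ge0_le_integral => //.
- by move=> x; exact: dphase_scale_ge0.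
- exact: mmeasurable_dphase_scale.
- exact: measurable_funeM.
move=> x Dx; have [px qx ax] := pqa Dx.
by apply: dphase_shrink; rewrite ?b0 ?f0.
Qed.

Lemma dmodularZ (b : R) f : (0 <= b)%R ->
  dmodular p q a m D (fun x => b%:E * f x) =
  \int[meas m]_(x in D) dphase p q a x (b%:E * `|f x|).
Proof.
by move=> b0; apply: eq_integral => x _; rewrite abseM gee0_abs.
Qed.

Lemma integral_dphase_abs (b : R) f : (forall x, D x -> 0 <= f x) ->
  \int[meas m]_(x in D) dphase p q a x (b%:E * `|f x|) =
  \int[meas m]_(x in D) dphase p q a x (b%:E * f x).
Proof.
by move=> f0; apply: eq_integral => x /set_mem Dx; rewrite gee0_abs ?f0.
Qed.

(** [LH] asks for a finite modular of [f] itself; the Delta_2 property extends this to all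
    multiples. [Num.max 1 b] replaces [b] because [dphase_dilate] takes factors at least 1. *)
Lemma integral_dphase_lty (N b : R) f : (0 <= b)%R ->
  {ae meas m, forall x, D x -> (p x <= N)%R /\ (q x <= N)%R} ->
  LH p q a m D f ->
  \int[meas m]_(x in D) dphase p q a x (b%:E * `|f x|) < +oo.
Proof.
move=> b0 pqN [mf foo]; have mabs := mmeasurable_abse mf.
have c1 : (1 <= Num.max 1 b)%R by rewrite le_max lexx.
have c0 : (0 <= Num.max 1 b)%R by rewrite (le_trans ler01).
apply: (@le_lt_trans _ _ (\int[meas m]_(x in D)
    ((Num.max 1 b `^ N)%:E * dphase p q a x `|f x|))).
  have mphi : mmeasurable m D (fun x => dphase p q a x `|f x|).
    by apply: mmeasurable_dphase => // x /pqa[].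
  apply: ae_ge0_le_integral => //.
  - by move=> x; exact: dphase_scale_ge0.
  - exact: mmeasurable_dphase_scale.
  - by move=> x Dx; rewrite mule_ge0 ?dphase_scale_ge0// lee_fin powR_ge0.
  - exact: measurable_funeM.
  apply: ae_cara_sub pqN => x pqNx Dx; have [pN qN] := pqNx Dx.
  have [px qx ax] := pqa Dx.
  apply: le_trans (dphase_dilate ax c1 pN qN (abse_ge0 (f x))).
  apply: le_dphase => //; first by rewrite mule_ge0.
  by rewrite lee_wpmul2r// lee_fin le_max lexx orbT.
rewrite ge0_integralZl_EFin ?powR_ge0//.
- by rewrite lte_mul_pinfty// lee_fin powR_ge0.
- by move=> x; exact: dphase_scale_ge0.
- by apply: mmeasurable_dphase => // x /pqa[].
Qed.

Lemma LH_norm_ge0 f : 0 <= LH_norm p q a m D f.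
Proof. by apply: le_ereal_inf_tmp => _ [t [t0 _] <-]; rewrite lee_fin ltW. Qed.

Lemma LH_norm_lt f (t : R) : mmeasurable m D f -> LH_norm p q a m D f < t%:E ->
  \int[meas m]_(x in D) dphase p q a x (t^-1%:E * `|f x|) <= 1.
Proof.
move=> mf /ereal_inf_lt[_ [s [s0 fs] <-]]; rewrite lte_fin => st.
apply: le_trans fs; rewrite dmodularZ ?invr_ge0 ?(ltW s0)//.
have t0 : (0 < t)%R by exact: lt_trans st.
apply: ge0_le_integral => //.
- by move=> x; exact: dphase_scale_ge0.
- by apply: mmeasurable_dphase_scale; rewrite ?invr_ge0 ?(ltW t0)//; exact: mmeasurable_abse.
- by apply: mmeasurable_dphase_scale; rewrite ?invr_ge0 ?(ltW s0)//; exact: mmeasurable_abse.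
move=> x Dx; have [px qx ax] := pqa Dx; apply: le_dphase => //.
  by rewrite mule_ge0// lee_fin invr_ge0 ltW.
by rewrite lee_wpmul2r// lee_fin lef_pV2 ?posrE// ltW.
Qed.

Lemma LH_norm_le f (t : R) : (0 < t)%R ->
  \int[meas m]_(x in D) dphase p q a x (t^-1%:E * `|f x|) <= 1 ->
  LH_norm p q a m D f <= t%:E.
Proof.
move=> t0 ft; apply: ereal_inf_lbound; exists t => //; split => //.
by rewrite dmodularZ// invr_ge0 ltW.
Qed.

(** Integrating [le_dphase1] at [|f| / t] bounds the integral of [|f|] by [t * (m D + 1)] for every
    [t > 0]. *)
Lemma LH_norm_eq0 f : m D < +oo -> mmeasurable m D f ->
  LH_norm p q a m D f = 0 -> {ae meas m, forall x, D x -> f x = 0}.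
Proof.
move=> Doo mf f0; have mabs := mmeasurable_abse mf.
suff : \int[meas m]_(x in D) `|f x| = 0.
  by move=> /(ae_eq_integral_abs (meas m) mD mf).
have Dfin : m D \is a fin_num by rewrite ge0_fin_numE.
have fle (t : R) : (0 < t)%R ->
    \int[meas m]_(x in D) `|f x| <= (t * (fine (m D) + 1))%:E.
  move=> t0; have ft : LH_norm p q a m D f < t%:E by rewrite f0 lte_fin.
  have mt : mmeasurable m D (fun x => dphase p q a x (t^-1%:E * `|f x|)).
    by apply: mmeasurable_dphase_scale; rewrite ?invr_ge0 ?(ltW t0).
  have cst1 : \int[meas m]_(x in D) cst 1 x = m D by rewrite integral_cst ?mul1e.
  rewrite EFinM EFinD fineK// -cst1.
  apply: le_trans (lee_wpmul2l _ (leeD2l _ (LH_norm_lt mf ft))); last first.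
    by rewrite lee_fin ltW.
  rewrite -ge0_integralD//; last by move=> x; exact: dphase_scale_ge0.
  rewrite -ge0_integralZl_EFin ?(ltW t0)//; last 2 first.
  - by move=> x Dx; rewrite adde_ge0// dphase_scale_ge0.
  - by apply: emeasurable_funD => //; exact: measurable_cst.
  apply: ge0_le_integral => //.
  - by apply: measurable_funeM; apply: emeasurable_funD => //; exact: measurable_cst.
  move=> x Dx; have [px qx ax] := pqa Dx.
  rewrite -lee_pdivrMl// le_dphase1// mule_ge0// lee_fin invr_ge0 ltW//.
apply/eqP; rewrite eq_le integral_ge0// andbT; apply/lee_addgt0Pr => e e0.
have D1 : (0 < fine (m D) + 1)%R by rewrite ltr_wpDl// fine_ge0.
rewrite add0e; have := fle (e / (fine (m D) + 1))%R.
by rewrite divfK ?gt_eqF//; apply; rewrite divr_gt0.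
Qed.

End orlicz.

Lemma ess_sup_on_bound {R : realType} {X : completeMetricType R}
    (m : {outer_measure set X -> \bar R}) (D : set X) (f : X -> R) :
  ess_sup_on m D f < +oo ->
  exists N : R, {ae meas m, forall x, D x -> (f x <= N)%R}.
Proof.
move=> /ereal_inf_lt[y fy yoo]; exists (fine y); apply: ae_cara_sub fy => x fxy Dx.
by move: fxy; rewrite /patch mem_set//=; case: y yoo => [y| |].
Qed.

(** * The trace *)

(* The limit is unique when it exists; otherwise the value is the junk [0]. *)
Definition trace {R : realType} {X : completeMetricType R}
    (mu : {outer_measure set X -> \bar R}) (Om : set X) (u : X -> \bar R) (z : X) : R :=
  xget 0%R [set t : R |
    avg mu (ball z r `&` Om) (fun y => `|u y - t%:E|) @[r --> 0^'+] --> 0].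

Section trace_limit.
Context {R : realType} {X : completeMetricType R}.
Variables (mu : {outer_measure set X -> \bar R}) (Om : set X).
Hypothesis mu_regular : borel_regular mu.
Hypothesis Om_open : open Om.
Hypothesis mu_ball_Om : forall (x : X) (r : R), closure Om x -> (0 < r)%R ->
  0 < mu (ball x r `&` Om) < +oo.
Variables (C : R) (C1 : (1 <= C)%R).
Hypothesis doubling : forall (x : X) (r : R), closure Om x -> (0 < r)%R ->
  mu (ball x (2 * r) `&` Om) <= C%:E * mu (ball x r `&` Om).
Implicit Types u v : X -> \bar R.

Lemma trace_eq u z t : closure Om z -> mmeasurable mu Om u ->
  avg mu (ball z r `&` Om) (fun y => `|u y - t%:E|) @[r --> 0^'+] --> 0 ->
  trace mu Om u z = t.
Proof.
move=> Oz mu_u ut.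
have tu := xgetPex 0%R (ex_intro [set t : R | avg mu (ball z r `&` Om)
  (fun y => `|u y - t%:E|) @[r --> 0^'+] --> 0] t ut).
exact: (ball_average_unique mu_regular Om_open mu_ball_Om Oz mu_u tu ut).
Qed.

Variables (Cp lam rho : R) (Cp0 : (0 < Cp)%R) (lam1 : (1 < lam)%R) (rho0 : (0 < rho)%R).
Variables (n : nat) (lam_n : (lam <= 2 ^+ n)%R).
Variables (u g : X -> \bar R).
Hypotheses (iu : (meas mu).-integrable Om u) (ig : (meas mu).-integrable Om g).
Hypothesis g0 : forall x, Om x -> 0 <= g x.
Hypothesis poincare : forall (x : X) (r : R), (0 < r)%R -> closure Om x ->
  avg mu (ball x r `&` Om) (fun y => `|u y - avg mu (ball x r `&` Om) u|) <=
    (Cp * r)%:E * avg mu (ball x (lam * r) `&` Om) g.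

Let P := multiscale mu Om rho (fun _ x => `|u x| + g x).

(** The outer 2 serves the absorption in [modular_trace]. The term [2 * C ^+ n] bounds the first
    average: its weight in [P] is 1/2, and [n] doublings enlarge the radius [rho / lam] to at least
    [rho]. The other term sums the oscillations: [C] comes from [ball_average_limit], and [Cp] times
    the radius is [2 * (Cp * (rho / lam))] times the weight. *)
Definition trace_constant : R := (2 * (2 * C ^+ n + C * (2 * (Cp * (rho / lam)))))%R.

Let C0 : (0 <= C)%R. Proof. exact: le_trans C1. Qed.
Let lam0 : (0 < lam)%R. Proof. exact: lt_trans lam1. Qed.

Lemma trace_limit z : closure Om z -> P z < +oo ->
  [/\ fine (avg mu (ball z (2^-1 ^+ k * (rho / lam)) `&` Om) u) @[k --> \oo]
        --> trace mu Om u z,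
      (2 * `|trace mu Om u z|)%:E <= trace_constant%:E * P z &
      avg mu (ball z r `&` Om) (fun y => `|u y - (trace mu Om u z)%:E|)
        @[r --> 0^'+] --> 0].
Proof.
move=> Oz Poo.
have mO := open_cara mu_regular Om_open.
have mB r := ballOm_cara mu_regular Om_open z r.
have BO r : ball z r `&` Om `<=` Om by exact: subIsetr.
have mu_u : mmeasurable mu Om u by exact: measurable_int iu.
have mg : mmeasurable mu Om g by exact: measurable_int ig.
have mB_ r f : mmeasurable mu Om f -> mmeasurable mu (ball z r `&` Om) f.
  by move=> mf; exact: measurable_funS mf.
have mabs : mmeasurable mu Om (fun x => `|u x|) by exact: mmeasurable_abse.
have gB0 r x : (ball z r `&` Om) x -> 0 <= g x by move=> [_]; exact: g0.
pose s k : R := (2^-1 ^+ k * rho)%R.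
have s0 k : (0 < s k)%R by rewrite mulr_gt0// exprn_gt0.
pose w k : R := (2^-1 * 2^-1 ^+ k)%R.
have w0 k : (0 <= w k)%R by rewrite mulr_ge0// exprn_ge0.
pose G k := avg mu (ball z (s k) `&` Om) g.
pose U k := avg mu (ball z (s k) `&` Om) (fun x => `|u x|).
have G0 k : 0 <= G k by apply: avg_ge0; exact: gB0.
have U0 k : 0 <= U k by apply: avg_ge0.
have Gfin k : G k \is a fin_num.
  by apply: avg_fin_num => //; exact: integrableS ig.
have PE : P z = \sum_(0 <= k <oo) (w k)%:E * (U k + G k).
  rewrite /P /multiscale; apply: eq_eseriesr => k _; rewrite avgD//.
  - exact: gB0.
  - exact: mB_.
  - exact: mB_.
have wUG0 k : 0 <= (w k)%:E * (U k + G k) by rewrite mule_ge0 ?lee_fin// adde_ge0.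
have rho' : (0 < rho / lam)%R by rewrite divr_gt0.
pose e k : R := (2 * (Cp * (rho / lam)) * (w k * fine (G k)))%R.
have eE k : (e k)%:E = (2 * (Cp * (rho / lam)))%:E * ((w k)%:E * G k).
  by rewrite /e EFinM [(w k * _)%:E]EFinM fineK.
have c0 : (0 < 2 * (Cp * (rho / lam)))%R by rewrite mulr_gt0// mulr_gt0.
have esum : \sum_(0 <= k <oo) (e k)%:E <= (2 * (Cp * (rho / lam)))%:E * P z.
  rewrite PE -nneseriesZl; last by move=> k _; exact: wUG0.
  apply: lee_nneseries => k _; rewrite eE.
    by move=> _; rewrite mule_ge0 ?lee_fin ?(ltW c0)// mule_ge0 ?lee_fin.
  rewrite lee_wpmul2l ?lee_fin ?(ltW c0)// lee_wpmul2l ?lee_fin// leeDr//.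
(* Starting from radius [rho / lam] makes the enlarged ball of the Poincare inequality at step [k]
   the ball of radius [s k] that occurs in [P]. *)
have [||t [vt tle ut]] := ball_average_limit mu_regular Om_open mu_ball_Om C1
    doubling iu Oz rho' (e := e).
- move=> k; apply: le_trans (poincare _ Oz) _; first by rewrite mulr_gt0// exprn_gt0.
  rewrite (_ : lam * (2^-1 ^+ k * (rho / lam)) = s k)%R; last first.
    by rewrite mulrCA [(lam * _)%R]mulrC divfK ?gt_eqF.
  rewrite eE /w -/(G k); move: (G k) => y.
  rewrite muleA -EFinM le_eqVlt; apply/orP; left; apply/eqP.
  by congr (_%:E * _); field; rewrite gt_eqF.
- by apply: le_lt_trans esum _; rewrite lte_mul_pinfty// lee_fin ltW.
rewrite (trace_eq Oz mu_u ut); split => //.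
have U0P : U 0%N <= 2%:E * P z.
  rewrite -lee_pdivrMl// PE.
  apply: le_trans (nneseries_lim_ge 1 (fun k _ _ => wUG0 k)).
  rewrite big_nat1 /w expr0 mulr1 lee_wpmul2l//.
  by rewrite leeDl.
have BU : avg mu (ball z (2^-1 ^+ 0 * (rho / lam)) `&` Om) (fun x => `|u x|) <=
    (C ^+ n)%:E * U 0%N.
  rewrite /U /s !expr0 !mul1r; apply: avg_subset => //.
  - apply: setSI; apply: le_ball; rewrite ler_pdivrMr// ler_peMr ?(ltW rho0)//.
    exact: ltW.
  - by case/andP: (mu_ball_Om Oz rho').
  - by case/andP: (mu_ball_Om Oz rho0).
  - apply: le_trans (doubling_iter C1 doubling n Oz rho').
    apply: le_outer_measure; apply: setSI; apply: le_ball.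
    by rewrite mulrA ler_pdivlMr// mulrC ler_pM2r.
  - exact: mB_.
rewrite EFinM [trace_constant]/(trace_constant) /trace_constant EFinM -muleA.
rewrite lee_wpmul2l// (le_trans tle)// EFinD ge0_muleDl ?lee_fin; last 2 first.
- by rewrite mulr_ge0// exprn_ge0.
- by rewrite mulr_ge0// ltW.
apply: leeD.
  apply: (le_trans BU); rewrite [(2 * _)%R]mulrC EFinM -muleA.
  by rewrite lee_wpmul2l ?lee_fin ?exprn_ge0.
by rewrite EFinM -muleA lee_wpmul2l ?lee_fin.
Qed.

End trace_limit.

(* [min_wug] is [cst 0] when there is no minimal gradient; since the Poincare
   inequality and the norm both refer to [min_wug], its existence is not needed. *)
Lemma min_wug_LH {R : realType} {X : completeMetricType R} (p q a : X -> R)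
    (mu : {outer_measure set X -> \bar R}) (Om : set X) (u : X -> \bar R) :
  (forall x, Om x -> [/\ (1 < p x)%R, (1 < q x)%R & (0 <= a x)%R]) ->
  LH p q a mu Om (min_wug p q a mu Om u) /\
  forall x, Om x -> 0 <= min_wug p q a mu Om u x.
Proof.
move=> pqa; rewrite /min_wug.
case: xgetP => [g _ [[[_ g0 _] gLH] _]|_] //; split => //; split.
  exact: measurable_cst.
rewrite /dmodular integral0_eq// => x /pqa[px qx ax].
by rewrite abse0 dphase0.
Qed.

(** * Modular and norm bounds for the trace of one function *)

Section trace_operator.
Context {R : realType} {X : completeMetricType R}.
Variables (mu nu : {outer_measure set X -> \bar R}) (Om : set X).
Hypotheses (mu_regular : borel_regular mu) (nu_regular : borel_regular nu).
Hypothesis Om_open : open Om.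
Hypothesis mu_ball_Om : forall (x : X) (r : R), closure Om x -> (0 < r)%R ->
  0 < mu (ball x r `&` Om) < +oo.
Hypothesis mu_Om : mu Om < +oo.
Variables (C : R) (C1 : (1 <= C)%R).
Hypothesis doubling : forall (x : X) (r : R), closure Om x -> (0 < r)%R ->
  mu (ball x (2 * r) `&` Om) <= C%:E * mu (ball x r `&` Om).
Variables (p q a : X -> R).
Hypothesis pqa : forall x, closure Om x ->
  [/\ (1 < p x)%R, (1 < q x)%R & (0 <= a x)%R].
Hypotheses (mp : mmeasurable mu Om (EFin \o p)) (mq : mmeasurable mu Om (EFin \o q)).
Hypothesis ma : mmeasurable mu Om (EFin \o a).
Hypotheses (np : mmeasurable nu (bdry Om) (EFin \o p))
  (nq : mmeasurable nu (bdry Om) (EFin \o q)).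
Hypothesis na : mmeasurable nu (bdry Om) (EFin \o a).
Variable N : R.
Hypothesis pqN : {ae meas mu, forall x, Om x -> (p x <= N)%R /\ (q x <= N)%R}.
Variables (c rho M : R) (c1 : (1 <= c)%R) (rho0 : (0 < rho)%R) (M0 : (0 <= M)%R).
Hypothesis modular_bound : forall (F : nat -> X -> \bar R) (E : R),
  (forall k, mmeasurable mu Om (F k)) -> (forall k x, Om x -> 0 <= F k x) ->
  (forall k, \int[meas mu]_(x in Om) dphase p q a x (c%:E * F k x) <= E%:E) ->
  exists A : X -> \bar R, [/\ mmeasurable nu (bdry Om) A, forall x, 0 <= A x,
    \int[meas nu]_(x in bdry Om) A x <= (M * E)%:E &
    forall z (s : R), bdry Om z -> (0 <= s)%R ->
      multiscale mu Om rho F z * dphase p q a z s%:E <=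
        s%:E * A z + s%:E * dphase p q a z s%:E].
Variables (Cp lam : R) (Cp0 : (0 < Cp)%R) (lam1 : (1 < lam)%R).
Variables (n : nat) (lam_n : (lam <= 2 ^+ n)%R).
Variables (u g : X -> \bar R).
Hypotheses (u_LH : LH p q a mu Om u) (g_LH : LH p q a mu Om g).
Hypothesis g0 : forall x, Om x -> 0 <= g x.
Hypothesis poincare : forall (x : X) (r : R), (0 < r)%R -> closure Om x ->
  avg mu (ball x r `&` Om) (fun y => `|u y - avg mu (ball x r `&` Om) u|) <=
    (Cp * r)%:E * avg mu (ball x (lam * r) `&` Om) g.

Let f x := `|u x| + g x.
Let P := multiscale mu Om rho (fun=> f).
Let H := trace_constant C Cp lam rho n.

Let mO : mu.-cara.-measurable Om. Proof. exact: open_cara. Qed.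
Let mE : nu.-cara.-measurable (bdry Om). Proof. exact: bdry_cara. Qed.
Let bdryO : bdry Om `<=` closure Om. Proof. by move=> x []. Qed.
Let pqaO x : Om x -> [/\ (1 < p x)%R, (1 < q x)%R & (0 <= a x)%R].
Proof. by move=> /subset_closure; exact: pqa. Qed.
Let pqaE x : bdry Om x -> [/\ (1 < p x)%R, (1 < q x)%R & (0 <= a x)%R].
Proof. by move=> /bdryO; exact: pqa. Qed.
Let mabs : mmeasurable mu Om (fun x => `|u x|).
Proof. by apply: mmeasurable_abse; exact: u_LH.1. Qed.
Let mf : mmeasurable mu Om f.
Proof. by apply: emeasurable_funD; [exact: mabs|exact: g_LH.1]. Qed.
Let f0 x : Om x -> 0 <= f x.
Proof. by move=> Ox; rewrite adde_ge0// g0. Qed.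
Let iu : (meas mu).-integrable Om u.
Proof. by apply: (LH_integrable mO mp mq ma pqaO mu_Om); exact: u_LH. Qed.
Let ig : (meas mu).-integrable Om g.
Proof. by apply: (LH_integrable mO mp mq ma pqaO mu_Om); exact: g_LH. Qed.
Let c0 : (0 < c)%R. Proof. exact: lt_le_trans c1. Qed.

Let C0 : (0 < C)%R. Proof. exact: lt_le_trans C1. Qed.
Let lam0 : (0 < lam)%R. Proof. exact: lt_trans lam1. Qed.

Lemma trace_constant_gt0 : (0 < H)%R.
Proof.
rewrite /H /trace_constant mulr_gt0// ltr_wpDr//.
  rewrite mulr_ge0 ?(ltW C0)// mulr_ge0// mulr_ge0 ?(ltW Cp0)//.
  by rewrite divr_ge0 ?(ltW rho0) ?(ltW lam0).
by rewrite mulr_gt0// exprn_gt0.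
Qed.

Lemma modular_sum_lty (b : R) : (0 <= b)%R ->
  \int[meas mu]_(x in Om) dphase p q a x (b%:E * f x) < +oo.
Proof.
move=> b0; apply: le_lt_trans (integral_dphaseD mO mp mq ma pqaO b0 _ g0 mabs g_LH.1) _ => //.
have b20 : (0 <= 2 * b)%R by rewrite mulr_ge0.
rewrite lte_add_pinfty//; first exact: (integral_dphase_lty mO mp mq ma pqaO b20 pqN).
rewrite -integral_dphase_abs//.
exact: (integral_dphase_lty mO mp mq ma pqaO b20 pqN).
Qed.

(** At [s = 1] the estimate reads [P z * (1 + a z) <= A z + (1 + a z)], and [A] is integrable, hence
    finite almost everywhere. *)
Lemma multiscale_lty : {ae meas nu, forall z, bdry Om z -> P z < +oo}.
Proof.
have Efin : \int[meas mu]_(x in Om) dphase p q a x (c%:E * f x) \is a fin_num.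
  rewrite ge0_fin_numE ?modular_sum_lty ?(ltW c0)//.
  by apply: integral_ge0 => x; exact: (dphase_scale_ge0 pqaO).
have [|||A [mA A0 AE PA]] := @modular_bound (fun=> f)
    (fine (\int[meas mu]_(x in Om) dphase p q a x (c%:E * f x))).
- by move=> _; exact: mf.
- by move=> _; exact: f0.
- by move=> _; rewrite fineK.
have iA : (meas nu).-integrable (bdry Om) A.
  apply/integrableP; split => //.
  under eq_integral do rewrite gee0_abs//.
  by rewrite (le_lt_trans AE) ?ltry.
have := integrable_ae mE iA.
apply: ae_cara_sub => z Az Ez; have [pz qz az] := pqaE Ez.
have := PA z 1%R Ez ler01; rewrite !mul1e dphase_EFin => PAz.
rewrite ltNge leye_eq; apply/negP => /eqP Pz; move: PAz; rewrite -/P Pz.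
rewrite !powR1 mulr1 gt0_mulye ?lte_fin; last by rewrite ltr_wpDr.
by rewrite -(fineK (Az Ez)) -EFinD leye_eq.
Qed.

(** Where [P] is finite the trace is the limit of a sequence of measurable averages; the rest is
    null, and the Caratheodory measure is complete. *)
Lemma mmeasurable_trace : mmeasurable nu (bdry Om) (EFin \o trace mu Om u).
Proof.
have mP : mmeasurable nu (bdry Om) P.
  apply: (@ge0_emeasurable_sum _ (caratheodory_type nu) _ _
    (fun k z => (2^-1 * 2^-1 ^+ k)%:E * avg mu (ball z (2^-1 ^+ k * rho) `&` Om) f) xpredT).
    move=> k z _ _; rewrite mule_ge0//.
    by apply: avg_ge0 => x [_]; exact: f0.
  by move=> k _; apply: measurable_funeM; exact: mmeasurable_ball_avg.
pose D := bdry Om `&` [set z | P z < +oo].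
have mD : nu.-cara.-measurable D by exact: emeasurable_fun_infty_o.
have mt : mmeasurable nu D (EFin \o trace mu Om u).
  apply: (@emeasurable_fun_cvg _ (caratheodory_type nu) _ _ (fun k z =>
      avg mu (ball z (2^-1 ^+ k * (rho / lam)) `&` Om) u)).
    by move=> k; apply: mmeasurable_ball_avg => //; exact: u_LH.1.
  move=> z [Ez Pz].
  have [ut _ _] := trace_limit mu_regular Om_open mu_ball_Om C1 doubling Cp0 lam1
    rho0 lam_n iu ig g0 poincare (bdryO Ez) Pz.
  apply: cvg_EFin ut; apply: nearW => k; apply: avg_fin_num.
    exact: ballOm_cara.
  by apply: integrableS iu => //; exact: ballOm_cara.
have cnu := @measure_is_complete_caratheodory R X nu.
apply: (ae_measurable_fun cnu (f := (EFin \o trace mu Om u) \_ D)).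
  apply: ae_cara_sub multiscale_lty => z Pz Ez.
  by rewrite patchE mem_set//; split => //; exact: Pz.
apply/(@measurable_restrict _ _ (caratheodory_type nu) _ D (bdry Om)) => //.
by rewrite setIidr//; move=> z [].
Qed.

(** For [s = |trace| / t], twice [s] is at most the multiscale sum of [(H / t) * f], so
    [modular_bound] gives [2 * s * phi s <= s * A + s * phi s]. For [s > 0] this is [phi s <= A]. *)
Lemma modular_trace (t E : R) : (0 < t)%R ->
  \int[meas mu]_(x in Om) dphase p q a x ((c * (H / t))%:E * f x) <= E%:E ->
  \int[meas nu]_(z in bdry Om)
    dphase p q a z (t^-1%:E * `|(trace mu Om u z)%:E|) <= (M * E)%:E.
Proof.
move=> t0 fE; have H0 := trace_constant_gt0.
have Ht : (0 < H / t)%R by rewrite divr_gt0.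
have [|||A [mA A0 AE PA]] := @modular_bound (fun _ x => (H / t)%:E * f x) E.
- by move=> _; exact: measurable_funeM.
- by move=> _ x Ox; rewrite mule_ge0 ?f0// lee_fin ltW.
- by move=> _; under eq_integral do rewrite muleA -EFinM.
apply: le_trans AE; apply: ae_ge0_le_integral => //.
- by move=> z; exact: (dphase_scale_ge0 pqaE).
- apply: (mmeasurable_dphase_scale np nq na pqaE) => //.
    by rewrite invr_ge0 ltW.
  by apply: mmeasurable_abse; exact: mmeasurable_trace.
apply: ae_cara_sub multiscale_lty => z Pz Ez.
have [pz qz az] := pqaE Ez.
have [_ tP _] := trace_limit mu_regular Om_open mu_ball_Om C1 doubling Cp0 lam1
    rho0 lam_n iu ig g0 poincare (bdryO Ez) (Pz Ez).
pose s := (t^-1 * `|trace mu Om u z|)%R.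
have s0 : (0 <= s)%R by rewrite mulr_ge0// invr_ge0 ltW.
rewrite -[t^-1%:E * _]/(s%:E).
have scale : multiscale mu Om rho (fun _ x => (H / t)%:E * f x) z = (H / t)%:E * P z.
  rewrite /P /multiscale -nneseriesZl; last first.
    move=> k _; rewrite mule_ge0//.
    by apply: avg_ge0 => x [_]; exact: f0.
  apply: eq_eseriesr => k _; rewrite avgZ ?(ltW Ht)//; last 3 first.
  - exact: ballOm_cara.
  - by move=> x [_]; exact: f0.
  - by apply: measurable_funS mf.
  by rewrite muleCA.
have sP : (2 * s)%:E <= (H / t)%:E * P z.
  rewrite /s mulrCA [(H / t)%R]mulrC EFinM [(t^-1 * H)%:E]EFinM -muleA.
  by rewrite lee_wpmul2l// lee_fin invr_ge0 ltW.
have := PA z s Ez s0; rewrite scale => /(le_trans (lee_wpmul2r _ sP)).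
rewrite dphase_ge0// => /(_ isT).
have [->|sN0] := eqVneq s 0%R; first by rewrite dphase0.
have {sN0}s_gt0 : (0 < s)%R by rewrite lt_neqAle eq_sym sN0.
rewrite dphase_EFin; move: (_ + _)%R => y; have := A0 z.
case: (A z) => [x _|_ _|//]; last by rewrite leey.
by rewrite -!EFinM -EFinD !lee_fin; nra.
Qed.

Lemma ae_trace_limit : {ae meas nu, forall z, bdry Om z ->
  avg mu (ball z r `&` Om) (fun y => `|u y - (trace mu Om u z)%:E|)
    @[r --> 0^'+] --> 0}.
Proof.
apply: ae_cara_sub multiscale_lty => z Pz Ez.
by have [] := trace_limit mu_regular Om_open mu_ball_Om C1 doubling Cp0 lam1
    rho0 lam_n iu ig g0 poincare (bdryO Ez) (Pz Ez).
Qed.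

Lemma LH_trace : LH p q a nu (bdry Om) (EFin \o trace mu Om u).
Proof.
split; first exact: mmeasurable_trace.
have b0 : (0 <= c * (H / 1))%R.
  by rewrite divr1 mulr_ge0 ?(ltW c0)// ltW// trace_constant_gt0.
have Efin : \int[meas mu]_(x in Om) dphase p q a x ((c * (H / 1))%:E * f x)
    \is a fin_num.
  rewrite ge0_fin_numE ?modular_sum_lty//.
  by apply: integral_ge0 => x; exact: (dphase_scale_ge0 pqaO).
have := @modular_trace 1 (fine _) ltr01 (eq_ind_r (fun x => _ <= x) (lexx _) (fineK Efin)).
rewrite invr1 /dmodular; under eq_integral do rewrite mul1e.
by move=> /le_lt_trans; apply; rewrite ltry.
Qed.

Lemma LH_norm_trace : LH_norm p q a nu (bdry Om) (EFin \o trace mu Om u) <=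
  (2 * c * H * (2 * M + 1))%:E * (LH_norm p q a mu Om u + LH_norm p q a mu Om g).
Proof.
have H0 := trace_constant_gt0.
set L := (2 * c * H * (2 * M + 1))%R.
have M1 : (0 < 2 * M + 1)%R by rewrite ltr_wpDl// mulr_ge0.
have L0 : (0 < L)%R by rewrite /L mulr_gt0// mulr_gt0// mulr_gt0.
have [nu0 ng0] := (LH_norm_ge0 p q a mu Om u, LH_norm_ge0 p q a mu Om g).
set nu_ := LH_norm p q a mu Om u in nu0 *; set ng := LH_norm p q a mu Om g in ng0 *.
have [|noo] := leP +oo (nu_ + ng).
  by rewrite leye_eq => /eqP ->; rewrite gt0_muley ?lte_fin// leey.
have fu : nu_ \is a fin_num.
  by rewrite ge0_fin_numE// (le_lt_trans _ noo)// leeDl.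
have fg : ng \is a fin_num.
  by rewrite ge0_fin_numE// (le_lt_trans _ noo)// leeDr.
apply/lee_addgt0Pr => e e0.
(* The infima defining the norms need not be attained: the margin [e / L] makes [t] exceed both
   norms strictly and costs only [e] after multiplication by [L]. *)
pose t := (fine nu_ + fine ng + e / L)%R.
have eL0 : (0 < e / L)%R by rewrite divr_gt0.
have fu0 : (0 <= fine nu_)%R by exact: fine_ge0.
have fg0 : (0 <= fine ng)%R by exact: fine_ge0.
have t0 : (0 < t)%R by rewrite ltr_wpDl// addr_ge0.
have Lt : (L * t = L * (fine nu_ + fine ng) + e)%R.
  by rewrite /t [LHS]mulrDr [(L * (e / L))%R]mulrC divfK ?gt_eqF.
have -> : L%:E * (nu_ + ng) + e%:E = (L * t)%:E.
  by rewrite Lt EFinD [(L * _)%:E]EFinM EFinD !fineK.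
apply: LH_norm_le; first by rewrite mulr_gt0.
have ut : \int[meas mu]_(x in Om) dphase p q a x (t^-1%:E * `|u x|) <= 1.
  apply: (LH_norm_lt mO mp mq ma pqaO u_LH.1).
  by rewrite -/nu_ -(fineK fu) lte_fin /t -addrA ltrDl ltr_wpDl.
have gt : \int[meas mu]_(x in Om) dphase p q a x (t^-1%:E * g x) <= 1.
  rewrite -integral_dphase_abs//.
  apply: (LH_norm_lt mO mp mq ma pqaO g_LH.1).
  by rewrite -/ng -(fineK fg) lte_fin /t addrAC ltrDr ltr_wpDl.
(* Shrinking by [kappa] makes each of the two modulars at most [kappa], and then
   [M * (2 * kappa) <= 1]. The factor 2 in [L] cancels the dilation by 2 in [integral_dphaseD]. *)
pose kappa := ((2 * M + 1)^-1)%R.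
have k01 : (0 <= kappa <= 1)%R.
  by rewrite invr_ge0 (ltW M1)/= invf_le1// lerDr mulr_ge0.
have scale : (2 * (c * (H / (L * t))) = kappa * t^-1)%R.
  by rewrite /kappa /L; field; rewrite !gt_eqF.
apply: (le_trans (modular_trace (E := (2 * kappa)%R) _ _)).
- by rewrite mulr_gt0.
- apply: le_trans (integral_dphaseD mO mp mq ma pqaO _ _ g0 mabs g_LH.1) _ => //.
    by rewrite mulr_ge0 ?(ltW c0)// divr_ge0 ?(ltW H0)// ltW// mulr_gt0.
  rewrite scale mulr_natl mulr2n EFinD; apply: leeD.
    under eq_integral do rewrite EFinM -muleA.
    apply: le_trans (integral_dphase_shrink mO mp mq ma pqaO k01 _ _) _ => //.
    - by move=> x Ox; rewrite mule_ge0// lee_fin invr_ge0 ltW.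
    - by apply: measurable_funeM; exact: mabs.
    - by rewrite -[leRHS]mule1 lee_wpmul2l// lee_fin; case/andP: k01.
  under eq_integral do rewrite EFinM -muleA.
  apply: le_trans (integral_dphase_shrink mO mp mq ma pqaO k01 _ _) _ => //.
  - by move=> x Ox; rewrite mule_ge0 ?g0// lee_fin invr_ge0 ltW.
  - by apply: measurable_funeM; exact: g_LH.1.
  - by rewrite -[leRHS]mule1 lee_wpmul2l// lee_fin; case/andP: k01.
by rewrite lee_fin /kappa mulrA ler_pdivrMr// mul1r mulrC lerDl.
Qed.

End trace_operator.

(** * Limits in mean of linear combinations and of almost equal functions *)

Section trace_linear.
Context {R : realType} {X : completeMetricType R}.
Variables (mu : {outer_measure set X -> \bar R}) (Om : set X).
Hypothesis mu_regular : borel_regular mu.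
Hypothesis Om_open : open Om.
Variables (u v : X -> \bar R).
Hypotheses (um : mmeasurable mu Om u) (vm : mmeasurable mu Om v).
Variable z : X.

Let mB r := ballOm_cara mu_regular Om_open z r.
Let mBf r (f : X -> \bar R) : mmeasurable mu Om f ->
  mmeasurable mu (ball z r `&` Om) f.
Proof. by apply: measurable_funS => //; exact: open_cara. Qed.
Let dist_ge0 (f : X -> \bar R) (t r : R) :
  0 <= avg mu (ball z r `&` Om) (fun y => `|f y - t%:E|).
Proof. by apply: avg_ge0 => y _; exact: abse_ge0. Qed.

Lemma ball_average_linear (c s t : R) :
  avg mu (ball z r `&` Om) (fun y => `|u y - s%:E|) @[r --> 0^'+] --> 0 ->
  avg mu (ball z r `&` Om) (fun y => `|v y - t%:E|) @[r --> 0^'+] --> 0 ->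
  avg mu (ball z r `&` Om) (fun y => `|c%:E * u y + v y - (c * s + t)%:E|)
    @[r --> 0^'+] --> 0.
Proof.
move=> /(cvge0P (dist_ge0 u s)) us /(cvge0P (dist_ge0 v t)) vt.
apply/cvge0P => [r|e e0]; first by apply: avg_ge0 => y _; exact: abse_ge0.
have c1 : (0 < 2 * (`|c| + 1))%R by rewrite mulr_gt0// ltr_wpDl.
have e2 : (0 < e / 2)%R by rewrite divr_gt0.
have ec : (0 < e / (2 * (`|c| + 1)))%R by rewrite divr_gt0.
near=> r.
have mU := mBf (r := r) um; have mV := mBf (r := r) vm.
apply: (@le_trans _ _ (avg mu (ball z r `&` Om)
    (fun y => (`|c|)%:E * `|u y - s%:E| + `|v y - t%:E|))).
  apply: le_avg => //.
  - apply: mmeasurable_dist; apply: emeasurable_funD => //.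
    exact: measurable_funeM.
  - apply: emeasurable_funD; last exact: mmeasurable_dist.
    by apply: measurable_funeM; exact: mmeasurable_dist.
  (* For [c = 0] infinite values of [u] are multiplied to 0. Otherwise an infinite value of [u] or
     [v] makes the right-hand side [+oo], so indeterminate sums on the left are harmless. *)
  move=> x _; have [->|cN0] := eqVneq c 0%R.
    by rewrite mul0e add0e mul0r add0r normr0 mul0e add0e.
  have cabs : (0 < `|c|)%R by rewrite normr_gt0.
  have cy : (`|c|)%:E * +oo = +oo :> \bar R by rewrite gt0_muley// lte_fin.
  case: (u x) => [y| |]; last 2 first.
  - by rewrite [X in _ <= _ * X + _](_ : _ = +oo)// cy addye ?leey// -ltNye (lt_le_trans ltNy0).
  - by rewrite [X in _ <= _ * X + _](_ : _ = +oo)// cy addye ?leey// -ltNye (lt_le_trans ltNy0).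
  case: (v x) => [w| |]; last 2 first.
  - by rewrite [X in _ <= _ + X](_ : _ = +oo)// addey ?leey.
  - by rewrite [X in _ <= _ + X](_ : _ = +oo)// addey ?leey.
  rewrite -!EFinM -!EFinD lee_fin -normrM (le_trans _ (ler_normD _ _))//.
  by rewrite le_eqVlt; apply/orP; left; apply/eqP; congr (`|_|%R); ring.
rewrite avgD//; last 2 first.
- by apply: measurable_funeM; exact: mmeasurable_dist.
- exact: mmeasurable_dist.
rewrite avgZ//; last exact: mmeasurable_dist.
rewrite [e]splitr EFinD; apply: leeD; last by near: r; exact: vt.
apply: (@le_trans _ _ ((`|c|)%:E * (e / (2 * (`|c| + 1)))%:E)).
  by rewrite lee_wpmul2l//; near: r; exact: us.
rewrite -EFinM lee_fin mulrCA ler_pM2l// ler_pdivrMr//.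
by rewrite mulrA mulVf// mul1r lerDl.
Unshelve. all: by end_near. Qed.

Lemma ball_average_ae_eq (t : R) : {ae meas mu, forall x, Om x -> u x = v x} ->
  avg mu (ball z r `&` Om) (fun y => `|u y - t%:E|) @[r --> 0^'+] --> 0 ->
  avg mu (ball z r `&` Om) (fun y => `|v y - t%:E|) @[r --> 0^'+] --> 0.
Proof.
move=> uv.
suff -> : (fun r => avg mu (ball z r `&` Om) (fun y => `|u y - t%:E|)) =
    (fun r => avg mu (ball z r `&` Om) (fun y => `|v y - t%:E|)) by [].
apply/funext => r; rewrite /avg; congr (_ * _); apply: ae_eq_integral => //.
- by apply: mmeasurable_dist; exact: mBf.
- by apply: mmeasurable_dist; exact: mBf.
- by apply: ae_cara_sub uv => x uvx [_ Ox]; rewrite uvx.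
Qed.

End trace_linear.

Theorem theorem3p1 (R : realType) (X : completeMetricType R)
  (mu : {outer_measure set X -> \bar R})
  (mu_regular : borel_regular mu)
  (mu_sfinite : sigma_finite [set: caratheodory_type mu] (meas mu))
  (mu_ball : forall (x : X) (r : R), (0 < r)%R -> 0 < mu (ball x r) < +oo)
  (Om : set X) (Om_domain : domain Om)
  (mu_ball_Om : forall (x : X) (r : R), closure Om x -> (0 < r)%R ->
    0 < mu (ball x r `&` Om) < +oo)
  (Om_doubling : restricted_doubling mu Om)
  (nu : {outer_measure set X -> \bar R})
  (nu_bdry : nu (~` bdry Om) = 0)
  (nu_regular : borel_regular nu)
  (nu_sfinite : sigma_finite [set: caratheodory_type nu] (meas nu))
  (theta : R) (theta_ge0 : (0 <= theta)%R) (theta_lt1 : (theta < 1)%R)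
  (nu_codim : upper_codimension theta mu nu Om)
  (p q a : X -> R)
  (pqa_closure : dphase_data p q a mu (closure Om))
  (pqa_bdry : dphase_data p q a nu (bdry Om))
  (Om_bounded : metric_bounded Om)
  (comparable : local_comparability p q a (closure Om))
  (poincare : weak_poincare p q a mu Om) :
  exists T : (X -> \bar R) -> (X -> R),
    [/\ (forall u, N1H p q a mu Om u -> LH p q a nu (bdry Om) (EFin \o T u)),
        (forall u v, N1H p q a mu Om u -> N1H p q a mu Om v ->
          N1H_equiv p q a mu Om u v ->
          {ae meas nu, forall z, bdry Om z -> T u z = T v z}),
        (forall (c : R) u v, N1H p q a mu Om u -> N1H p q a mu Om v ->
          {ae meas nu, forall z, bdry Om z ->
            T (fun x => c%:E * u x + v x) z = (c * T u z + T v z)%R}),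
        (exists C : R, forall u, N1H p q a mu Om u ->
          LH_norm p q a nu (bdry Om) (EFin \o T u) <=
            C%:E * N1H_norm p q a mu Om u) &
        (forall u, N1H p q a mu Om u ->
          {ae meas nu, forall z, bdry Om z ->
            avg mu (ball z r `&` Om) (fun y => `|u y - (T u z)%:E|)
              @[r --> 0^'+] --> 0})].
Proof.
have [Om_open _ Om_neq0] := Om_domain.
have [C C1 doubling] := Om_doubling.
have [K K0 codim] := nu_codim.
have [c [R0 [c1 R00 comp]]] := comparable.
have [Cp [lam [Cp0 lam1 poinc]]] := poincare.
have [[cmp cmq cma] cpq [_ poo] [_ qoo] _] := pqa_closure.
have [[np nq na] _ _ _ _] := pqa_bdry.
have pqa x : closure Om x -> [/\ (1 < p x)%R, (1 < q x)%R & (0 <= a x)%R].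
  by move=> /cpq[p1 pq a0]; split => //; exact: lt_trans pq.
have OmcOm : Om `<=` closure Om by exact: subset_closure.
have pqaO x : Om x -> [/\ (1 < p x)%R, (1 < q x)%R & (0 <= a x)%R].
  by move=> /OmcOm; exact: pqa.
have mO := open_cara mu_regular Om_open.
have restrict f : mmeasurable mu (closure Om) f -> mmeasurable mu Om f.
  move=> mf; apply: measurable_funS mf => //.
  by apply: closed_cara => //; exact: closed_closure.
have [mp mq ma] := And3 (restrict _ cmp) (restrict _ cmq) (restrict _ cma).
have [N pqN] : exists N : R,
    {ae meas mu, forall x, Om x -> (p x <= N)%R /\ (q x <= N)%R}.
  have [N1 pN1] := ess_sup_on_bound poo; have [N2 qN2] := ess_sup_on_bound qoo.
  exists (Num.max N1 N2); apply: ae_cara_sub (ae_cara_and pN1 qN2).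
  by move=> x [px qx] /OmcOm Ox; rewrite !le_max px// qx// orbT.
(* A bounded [Om] lies in a ball about one of its own points, where [mu_ball_Om] applies. *)
have mu_Om : mu Om < +oo.
  have [y Oy] := Om_neq0; have [x0 [r Or]] := Om_bounded.
  have r0 : (0 < 2 * (`|r| + 1))%R by rewrite mulr_gt0// ltr_wpDl.
  case/andP: (mu_ball_Om _ _ (OmcOm _ Oy) r0) => _; apply: le_lt_trans.
  apply: le_outer_measure => w Ow; split => //.
  apply: le_ball (ball_triangle (ball_sym (Or _ Oy)) (Or _ Ow)).
  by have := ler_norm r; lra.
(* The largest radius at which comparability is invoked; it must be below [R0]. *)
pose rho := (R0 / 2)%R.
have rho0 : (0 < rho)%R by rewrite divr_gt0.
have rhoR : (rho < R0)%R by rewrite /rho; lra.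
have c0 : (0 < c)%R by exact: lt_le_trans c1.
have [M M0 modular] := modular_estimate mu_regular nu_regular Om_open Om_bounded
  Om_neq0 mu_ball_Om C1 doubling theta_lt1 (ltW K0) codim pqa mp mq ma c0 comp
  rho0 rhoR.
have [n lam_n] : exists n, (lam <= 2 ^+ n)%R.
  by exists (Num.Def.archi_bound lam); apply: ltW; exact: upper_nthrootP.
have um u : N1H p q a mu Om u -> mmeasurable mu Om u by move=> [[]].
have gLH u := min_wug_LH mu u pqaO.
have poin u : N1H p q a mu Om u -> forall (x : X) (r : R), (0 < r)%R ->
    closure Om x ->
    avg mu (ball x r `&` Om) (fun y => `|u y - avg mu (ball x r `&` Om) u|) <=
    (Cp * r)%:E * avg mu (ball x (lam * r) `&` Om) (min_wug p q a mu Om u).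
  move=> [uLH ug] x r r0 Ox.
  have L1u : L1loc mu Om u.
    move=> A AO _ mA.
    exact: integrableS (LH_integrable mO mp mq ma pqaO mu_Om uLH).
  by have [_] := poinc u uLH.1 L1u ug; apply.
have lim u : N1H p q a mu Om u -> {ae meas nu, forall z, bdry Om z ->
    avg mu (ball z r `&` Om) (fun y => `|u y - (trace mu Om u z)%:E|)
      @[r --> 0^'+] --> 0}.
  move=> Hu; have [[uLH _] [gl g0]] := (Hu, gLH u).
  exact: (ae_trace_limit mu_regular nu_regular Om_open mu_ball_Om mu_Om C1
    doubling pqa mp mq ma pqN c1 rho0 modular Cp0 lam1 lam_n uLH gl g0 (poin u Hu)).
have bdryO : bdry Om `<=` closure Om by move=> x [].
exists (trace mu Om); split => //.
- move=> u Hu; have [[uLH _] [gl g0]] := (Hu, gLH u).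
  exact: (LH_trace mu_regular nu_regular Om_open mu_ball_Om mu_Om C1
    doubling pqa mp mq ma np nq na pqN c1 rho0 modular Cp0 lam1 lam_n uLH gl g0 (poin u Hu)).
- move=> u v Hu Hv; rewrite /N1H_equiv /N1H_norm => uv0.
  have muv : mmeasurable mu Om (fun x => u x - v x).
    by apply: emeasurable_funB; exact: um.
  have uv : {ae meas mu, forall x, Om x -> u x = v x}.
    have : LH_norm p q a mu Om (fun x => u x - v x) = 0.
      move: uv0 => /eqP; rewrite padde_eq0 ?LH_norm_ge0// => /andP[/eqP].
      by [].
    move=> /(LH_norm_eq0 mO mp mq ma pqaO mu_Om muv).
    apply: ae_cara_sub => x uvx /uvx.
    (* Since [+oo - +oo] is [-oo] in [\bar R], a difference equal to 0 forces both values to be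
       finite. *)
    by case: (u x) => [y| |]; case: (v x) => [w| |]//= [] /eqP; rewrite subr_eq0 => /eqP ->.
  apply: ae_cara_sub (lim u Hu) => z uz Ez; apply/esym.
  apply: (trace_eq mu_regular Om_open mu_ball_Om (bdryO _ Ez) (um _ Hv)).
  exact: (ball_average_ae_eq mu_regular Om_open (um _ Hu) (um _ Hv) uv (uz Ez)).
- move=> b u v Hu Hv.
  apply: ae_cara_sub (ae_cara_and (lim u Hu) (lim v Hv)) => z [uz vz] Ez.
  apply: (trace_eq mu_regular Om_open mu_ball_Om (bdryO _ Ez)).
    by apply: emeasurable_funD; [apply: measurable_funeM|]; exact: um.
  exact: (ball_average_linear mu_regular Om_open (um _ Hu) (um _ Hv) b (uz Ez) (vz Ez)).
(* The constant is found by unification, but as an existential variable created before [u] it cannot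
   depend on [u]. *)
- eexists => u Hu; have [[uLH _] [gl g0]] := (Hu, gLH u).
  exact: (LH_norm_trace mu_regular nu_regular Om_open mu_ball_Om mu_Om C1
    doubling pqa mp mq ma np nq na pqN c1 rho0 M0 modular Cp0 lam1 lam_n uLH gl g0 (poin u Hu)).
Qed.
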